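(* Let $G$ be a finite simple graph with vertex set $V=[n]$. Let $\mathcal D$ be the set of pairs $(\gamma,f)$ where $\gamma$ is an acyclic orientation of $G$ and $f:V\to\mathbb N=\{0,1,2,\ldots\}$ is a coloring without $\gamma$-descent. Then $$\omega(X_G)(\mathbf y+\mathbf z)=\sum_{(\gamma,f)\in\mathcal D}p_{\lambda(\gamma_0)}(\mathbf y)\prod_{i\ge1}z_i^{|f^{-1}(i)|},$$ where $\gamma_0$ is the restriction of $\gamma$ to the induced subgraph $G[f^{-1}(0)]$.
   Context: $\mathbf y=(y_1,y_2,\ldots)$, $\mathbf z=(z_1,z_2,\ldots)$. The chromatic symmetric function is $X_G(\mathbf z)=\sum_f\prod_{v}z_{f(v)}$ over proper colorings $f:V\to\{1,2,\ldots\}$. $\omega$ is the algebra automorphism of symmetric functions with $\omega(e_k)=h_k$ (so $\omega(p_k)=(-1)^{k-1}p_k$). For a symmetric function $F(\mathbf z)$, $F(\mathbf y+\mathbf z)$ is obtained by substituting $p_k$ by $p_k(\mathbf y)+p_k(\mathbf z)$ for all $k$, where $p_k(\mathbf y)=\sum_i y_i^k$ etc.; $p_\lambda=\prod_j p_{\lambda_j}$, with $p_\emptyset=1$. A coloring $f$ has no $\gamma$-descent if $f(u)\le f(v)$ for every arc $u\to v$ of $\gamma$. For an acyclic orientation $\gamma'$ of a graph on a vertex set $W\subseteq[n]$, $\lambda(\gamma')$ is the partition given by the sizes of its source-components in weakly decreasing order, where source-components are defined as: for $w\in W$ let $R_w$ be the set of vertices reachable from $w$ (with $w\in R_w$); recursively,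 if $\bigcup_{l<k}S_l=W$ then $S_k=\emptyset$, otherwise $S_k=R_m\setminus\bigcup_{l<k}S_l$ with $m=\min(W\setminus\bigcup_{l<k}S_l)$; the non-empty $S_k$ are the source-components. *)

(* Defs.v *)
From HB Require Import structures.
From mathcomp Require Import all_boot all_algebra finmap.
From mathcomp Require Import boolp classical_sets functions cardinality fsbigop.
From mathcomp.multinomials Require Import monalg.

Set Implicit Arguments.
Unset Strict Implicit.
Unset Printing Implicit Defensive.

Import GRing.Theory.

Local Open Scope classical_set_scope.
Local Open Scope ring_scope.

(* Formal power series with coefficients in R in the (possibly infinitely
   many) commuting variables indexed by I, as functions from monomials to
   coefficients. *)
Record series (R : comNzRingType) (I : choiceType) :=
  Series { scoef :> {cmonom I} -> R }.

HB.instance Definition _ R I := gen_eqMixin (series R I).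
HB.instance Definition _ R I := gen_choiceMixin (series R I).

Section SeriesTheory.
Context (R : comNzRingType) (I : choiceType).
Implicit Types (F G H : series R I) (m : {cmonom I}).

Lemma seriesP F G : (forall m, F m = G m) -> F = G.
Proof. by case: F G => [F] [G] /= FG; congr Series; apply/funext. Qed.

Definition szero : series R I := Series (fun=> 0).
Definition sopp F := Series (fun m => - F m).
Definition sadd F G := Series (fun m => F m + G m).
Definition sscale (a : R) F := Series (fun m => a * F m).
Definition smonom m0 : series R I := Series (fun m => (m == m0)%:R).
Definition smul F G :=
  Series (fun m => \sum_(ab \in [set ab | mmul ab.1 ab.2 = m]) F ab.1 * G ab.2).

Arguments smul : simpl never.

Lemma saddA : associative sadd.
Proof. by move=> F G H; apply: seriesP => m /=; rewrite addrA. Qed.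
Lemma saddC : commutative sadd.
Proof. by move=> F G; apply: seriesP => m /=; rewrite addrC. Qed.
Lemma sadd0 : left_id szero sadd.
Proof. by move=> F; apply: seriesP => m /=; rewrite add0r. Qed.
Lemma saddN : left_inverse szero sopp sadd.
Proof. by move=> F; apply: seriesP => m /=; rewrite addNr. Qed.

HB.instance Definition _ :=
  GRing.isZmodule.Build (series R I) saddA saddC sadd0 saddN.

Definition divisors_seq m : seq {cmonom I} :=
  undup [seq mkcmonom [fsfun i : finsupp m => g i : nat | 0%N]
        | g : {ffun finsupp m -> 'I_(mdeg m).+1}].

Lemma mem_divisors_seq m a b : mmul a b = m -> a \in divisors_seq m.
Proof.
move=> abm; have aE i : (a i + b i = m i)%N by rewrite -abm cmM.
rewrite mem_undup; apply/fintype.imageP.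
exists [ffun i : finsupp m => inord (a (val i))] => //.
apply/eqP/cmP => i; rewrite cmE fsfun_ffun.
case: insubP => [j _ ji|]; last first.
  by rewrite mem_finsupp negbK -aE addn_eq0 => /andP[/eqP].
rewrite /= ffunE ji inordK// ltnS (leq_trans (leq_addr (b i) _))// aE.
rewrite mdegE -ji (big_fsetD1 (val j)) ?leq_addr//; exact: valP.
Qed.

Definition dvdm a m := exists b, mmul a b = m.

Lemma smulE (D : seq {cmonom I}) F G m : uniq D ->
  (forall a, dvdm a m -> a \in D) ->
  smul F G m = \sum_(a <- D) \sum_(b <- D | mmul a b == m) F a * G b.
Proof.
move=> uD mD; rewrite /smul /=.
have -> : [set ab : {cmonom I} * {cmonom I} | mmul ab.1 ab.2 = m] =
          [set` [pred ab | mmul ab.1 ab.2 == m]].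
  by apply/seteqP; split => ab /=; rewrite inE /= => /eqP.
rewrite -(bigfs _ (r := [seq (a, b) | a <- D, b <- D])); first last.
- move=> [a b] /eqP /= abm /negP[]; apply/allpairsP; exists (a, b).
  by split => //; apply: mD; [exists b|exists a; rewrite mulmC].
- by apply: allpairs_uniq => // -[? ?] [? ?].
rewrite big_mkcond big_allpairs.
by apply: eq_bigr => a _; rewrite -big_mkcond.
Qed.

Lemma smulE_div F G m : smul F G m =
  \sum_(a <- divisors_seq m) \sum_(b <- divisors_seq m | mmul a b == m)
    F a * G b.
Proof.
apply: smulE; first exact: undup_uniq.
by move=> a [b /mem_divisors_seq].
Qed.

Lemma smulC : commutative smul.
Proof.
move=> F G; apply: seriesP => m; rewrite !smulE_div.
under eq_bigr do rewrite big_mkcond.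
rewrite exchange_big/=; apply: eq_bigr => a _; rewrite [RHS]big_mkcond.
by apply: eq_bigr => b _; rewrite mulmC mulrC.
Qed.

Lemma smulA : associative smul.
Proof.
move=> F G H; apply: seriesP => m.
set D := divisors_seq m.
have uD : uniq D := undup_uniq _.
have DD d : dvdm d m -> forall a, dvdm a d -> a \in D.
  move=> [c dcm] a [b abd]; apply: (@mem_divisors_seq _ _ (mmul b c)).
  by rewrite mulmA abd.
have Dm a : dvdm a m -> a \in D by move=> [b /mem_divisors_seq].
have L : smul F (smul G H) m = \sum_(a <- D) \sum_(b <- D) \sum_(c <- D)
   (if mmul a (mmul b c) == m then F a * (G b * H c) else 0).
  rewrite smulE_div; apply: eq_bigr => a _.
  transitivity (\sum_(d <- D) \sum_(b <- D) \sum_(c <- D)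
      (if (mmul a d == m) && (mmul b c == d) then F a * (G b * H c) else 0)).
    rewrite big_mkcond; apply: eq_bigr => d _.
    case: (eqVneq (mmul a d) m) => adm; last first.
      by rewrite big1// => b _; rewrite big1.
    rewrite (smulE (D := D))//; last by apply: DD; exists a; rewrite mulmC.
    rewrite mulr_sumr; apply: eq_bigr => b _.
    by rewrite mulr_sumr big_mkcond.
  rewrite exchange_big/=; apply: eq_bigr => b _.
  rewrite exchange_big/=; apply: eq_bigr => c _.
  case: (eqVneq (mmul a (mmul b c)) m) => abcm; last first.
    rewrite big1// => d _; case: eqP => // adm; case: eqP => //= bcd.
    by rewrite bcd adm eqxx in abcm.
  have bcD : mmul b c \in D by apply: Dm; exists a; rewrite mulmC.
  rewrite (bigD1_seq (mmul b c))//= abcm !eqxx/= big1 ?addr0// => d.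
  by rewrite eq_sym => /negbTE ->; rewrite andbF.
have Rr : smul (smul F G) H m = \sum_(a <- D) \sum_(b <- D) \sum_(c <- D)
   (if mmul a (mmul b c) == m then F a * (G b * H c) else 0).
  rewrite smulE_div.
  transitivity (\sum_(d <- D) \sum_(c <- D) \sum_(a <- D) \sum_(b <- D)
      (if (mmul d c == m) && (mmul a b == d) then F a * (G b * H c) else 0)).
    apply: eq_bigr => d _; rewrite big_mkcond; apply: eq_bigr => c _.
    case: (eqVneq (mmul d c) m) => dcm; last first.
      by rewrite big1// => b _; rewrite big1.
    rewrite (smulE (D := D))//; last by apply: DD; exists c.
    rewrite mulr_suml; apply: eq_bigr => a _.
    rewrite mulr_suml big_mkcond; apply: eq_bigr => b _.
    by rewrite mulrA.
  rewrite exchange_big/=.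
  under eq_bigr => c _ do (rewrite exchange_big/=;
    under eq_bigr => a _ do rewrite exchange_big/=).
  rewrite exchange_big/=; apply: eq_bigr => a _.
  rewrite exchange_big/=; apply: eq_bigr => b _; apply: eq_bigr => c _.
  rewrite mulmA.
  case: (eqVneq (mmul (mmul a b) c) m) => abcm; last first.
    rewrite big1// => d _; case: eqP => // adm; case: eqP => //= bcd.
    by rewrite bcd adm eqxx in abcm.
  have abD : mmul a b \in D by apply: Dm; exists c.
  rewrite (bigD1_seq (mmul a b))//= abcm !eqxx/= big1 ?addr0// => d.
  by rewrite eq_sym => /negbTE ->; rewrite andbF.
by rewrite L Rr.
Qed.

Lemma smonom_mul m0 F m :
  smul (smonom m0) F m = \sum_(b <- divisors_seq m | mmul m0 b == m) F b.
Proof.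
have uD : uniq (divisors_seq m) := undup_uniq _.
rewrite smulE_div; have [m0D|m0D] := boolP (m0 \in divisors_seq m).
  rewrite (bigD1_seq m0)//= [X in _ + X]big1 ?addr0.
    by apply: eq_bigr => b _; rewrite eqxx mul1r.
  by move=> a /negbTE am0; rewrite big1// => b _; rewrite am0 mul0r.
rewrite [RHS]big_pred0.
  rewrite big_seq big1// => a aD; rewrite big1// => b _.
  rewrite /=; case: eqVneq => [am0|_]; last by rewrite mul0r.
  by rewrite am0 (negbTE m0D) in aD.
by move=> b; apply/negbTE; apply: contra m0D => /eqP/mem_divisors_seq.
Qed.

Lemma smul1 : left_id (smonom mone) smul.
Proof.
move=> F; apply: seriesP => m; rewrite smonom_mul.
have mD : m \in divisors_seq m.
  by apply: (@mem_divisors_seq _ _ mone); rewrite mulm1.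
under eq_bigl do rewrite mul1m.
rewrite big_mkcond (bigD1_seq m) ?undup_uniq//= eqxx big1 ?addr0// => b.
by move=> /negbTE ->.
Qed.

Lemma smulDl : left_distributive smul sadd.
Proof.
move=> F G H; apply: seriesP => m.
rewrite -[RHS]/(smul F H m + smul G H m) !smulE_div -big_split/=.
apply: eq_bigr => a _; rewrite -big_split/=.
by apply: eq_bigr => b _; rewrite mulrDl.
Qed.

Lemma sone_neq0 : smonom mone != szero.
Proof.
apply/eqP => /(congr1 (fun F : series R I => F mone)) /= /eqP.
by rewrite eqxx oner_eq0.
Qed.

HB.instance Definition _ := GRing.Zmodule_isComNzRing.Build (series R I)
  smulA smulC smul1 smulDl sone_neq0.

Lemma sscaleA a b F : sscale a (sscale b F) = sscale (a * b) F.
Proof. by apply: seriesP => m /=; rewrite mulrA. Qed.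
Lemma sscale1 : left_id 1 sscale.
Proof. by move=> F; apply: seriesP => m /=; rewrite mul1r. Qed.
Lemma sscaleDr : right_distributive sscale +%R.
Proof. by move=> a F G; apply: seriesP => m /=; rewrite mulrDr. Qed.
Lemma sscaleDl F : {morph sscale^~ F : a b / a + b}.
Proof. by move=> a b; apply: seriesP => m /=; rewrite mulrDl. Qed.

HB.instance Definition _ := GRing.Zmodule_isLmodule.Build R (series R I)
  sscaleA sscale1 sscaleDr sscaleDl.

Lemma sscaleAl (a : R) F G : a *: (F * G) = (a *: F) * G.
Proof.
apply: seriesP => m; rewrite -[LHS]/(a * smul F G m).
rewrite -[RHS]/(smul (sscale a F) G m) !smulE_div mulr_sumr.
apply: eq_bigr => b _; rewrite mulr_sumr.
by apply: eq_bigr => c _; rewrite mulrA.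
Qed.

HB.instance Definition _ :=
  GRing.Lmodule_isLalgebra.Build R (series R I) sscaleAl.
HB.instance Definition _ := GRing.Lalgebra_isComAlgebra.Build R (series R I).

Lemma scoef0 m : (0 : series R I) m = 0. Proof. by []. Qed.
Lemma scoef1 m : (1 : series R I) m = (m == mone)%:R. Proof. by []. Qed.
Lemma scoefD F G m : (F + G) m = F m + G m. Proof. by []. Qed.
Lemma scoefN F m : (- F) m = - F m. Proof. by []. Qed.
Lemma scoefZ (a : R) F m : (a *: F) m = a * F m. Proof. by []. Qed.
Lemma scoefM F G m : (F * G) m =
  \sum_(ab \in [set ab | mmul ab.1 ab.2 = m]) F ab.1 * G ab.2.
Proof. by []. Qed.

Lemma smonom1 : smonom mone = 1. Proof. by []. Qed.

Lemma smonomM m1 m2 : smonom (mmul m1 m2) = smonom m1 * smonom m2.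
Proof.
apply: seriesP => m; rewrite -[RHS]/(smul _ _ _) smonom_mul /=.
have uD : uniq (divisors_seq m) := undup_uniq _.
have [->|mm] := eqVneq m (mmul m1 m2).
  have m2D : m2 \in divisors_seq (mmul m1 m2).
    by apply: (@mem_divisors_seq _ _ m1); rewrite mulmC.
  rewrite big_mkcond (bigD1_seq m2) ?undup_uniq//= !eqxx big1 ?addr0// => b.
  by move=> /negbTE ->; rewrite if_same.
rewrite big1// => b /eqP bm; case: eqP => // bm2.
by rewrite -bm bm2 eqxx in mm.
Qed.

(* The sum of a (possibly infinite) summable family, taken coefficientwise.
   Each coefficient is a finitely supported sum: if infinitely many F t with
   t in A have a nonzero coefficient at m, the value at m is 0. *)
Definition ssum (T : choiceType) (A : set T) (F : T -> series R I) :=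
  Series (fun m => \sum_(t \in A) F t m).

Definition svar (i : I) : series R I := smonom (ucm i).

Definition perm_invariant F := forall (s : I -> I) m m', bijective s ->
  (forall i, m' i = m (s i)) -> F m' = F m.

Definition bounded_degree F :=
  exists d, forall m, F m != 0 -> (mdeg m <= d)%N.

Definition symfun_pred : {pred series R I} :=
  fun F => `[< perm_invariant F /\ bounded_degree F >].

Definition relabel (s s' : I -> I) m : {cmonom I} :=
  mkcmonom [fsfun i in [fset s j | j in finsupp m]%fset => m (s' i) | 0%N].

Lemma relabelE s s' m i : cancel s s' -> cancel s' s ->
  relabel s s' m i = m (s' i).
Proof.
move=> sK s'K; rewrite cmE fsfun_fun; case: ifP => // /negbT iN.
apply/esym/eqP; apply: contraNT iN => /eqP mi.
apply/imfsetP; exists (s' i); last by rewrite s'K.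
by rewrite mem_finsupp; apply/eqP.
Qed.

Lemma relabelK s s' : cancel s s' -> cancel s' s ->
  cancel (relabel s s') (relabel s' s).
Proof.
by move=> sK s'K m; apply/eqP/cmP => i; rewrite !relabelE// sK.
Qed.

Lemma relabel1 s s' : cancel s s' -> cancel s' s -> relabel s s' mone = mone.
Proof. by move=> sK s'K; apply/eqP/cmP => i; rewrite relabelE// !cm1. Qed.

Lemma relabelM s s' m1 m2 : cancel s s' -> cancel s' s ->
  relabel s s' (mmul m1 m2) = mmul (relabel s s' m1) (relabel s s' m2).
Proof.
by move=> sK s'K; apply/eqP/cmP => i; rewrite cmM !relabelE// cmM.
Qed.

Lemma perm_invariantP F : perm_invariant F <->
  (forall s s' m, cancel s s' -> cancel s' s -> F (relabel s s' m) = F m).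
Proof.
split=> [Fs s s' m sK s'K|Fs s m m' [s' sK s'K] mm'].
  by apply: (Fs s') => [|i]; [exists s|rewrite relabelE].
rewrite -(Fs s' s m)//; congr (F _).
by apply/eqP/cmP => i; rewrite relabelE.
Qed.

Lemma symfun_subalg : GRing.subalg_closed symfun_pred.
Proof.
split.
- apply/asboolP; split.
    apply/perm_invariantP => s s' m sK s'K; rewrite !scoef1.
    by rewrite -{1}(relabel1 sK s'K) (can_eq (relabelK sK s'K)).
  exists 0%N => m; rewrite scoef1.
  by case: (eqVneq m mone) => [->|_ /eqP//]; rewrite mdeg1.
- move=> a F G /asboolP[/perm_invariantP Fs [d Fd]].
  move=> /asboolP[/perm_invariantP Gs [d' Gd]].
  apply/asboolP; split.
    apply/perm_invariantP => s s' m sK s'K.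
    by rewrite !scoefD !scoefZ Fs// Gs.
  exists (maxn d d') => m; rewrite scoefD scoefZ leq_max.
  case: (eqVneq (F m) 0) => [->|/Fd ->//].
  by rewrite mulr0 add0r => /Gd ->; rewrite orbT.
move=> F G /asboolP[/perm_invariantP Fs [d Fd]].
move=> /asboolP[/perm_invariantP Gs [d' Gd]].
apply/asboolP; split.
  apply/perm_invariantP => s s' m sK s'K; rewrite !scoefM.
  rewrite (reindex_fsbig (fun ab : {cmonom I} * {cmonom I} =>
    (relabel s s' ab.1, relabel s s' ab.2)) [set ab | mmul ab.1 ab.2 = m]).
    by apply: eq_fsbigr => ab _ /=; rewrite Fs// Gs.
  split=> [[a b] /= <-|[a b] [c d0] _ _ /= [ac bd]|[a b] /= abm].
  - by rewrite relabelM.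
  - by congr (_, _); apply: (can_inj (relabelK sK s'K)).
  exists (relabel s' s a, relabel s' s b) => /=.
    by rewrite -relabelM// abm relabelK.
  by rewrite !relabelK.
exists (d + d')%N => m FGm.
have [[a b] /= <- FG] : exists2 ab : {cmonom I} * {cmonom I},
    mmul ab.1 ab.2 = m & F ab.1 * G ab.2 != 0.
  apply: contrapT => N; move/eqP: FGm; apply; rewrite scoefM.
  apply: fsbig1 => ab abm; apply/eqP/negPn/negP => FG.
  by apply: N; exists ab.
rewrite mdegM leq_add//.
  by apply: Fd; apply: contraNneq FG => ->; rewrite mul0r.
by apply: Gd; apply: contraNneq FG => ->; rewrite mulr0.
Qed.

HB.instance Definition _ :=
  GRing.isSubalgClosed.Build R (series R I) symfun_pred symfun_subalg.

(* The algebra of symmetric functions in the variables indexed by I: the power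
   series of bounded degree that are invariant under permutation of the
   variables. *)
Record symfun := SymFun {
  symfun_val :> series R I;
  _ : symfun_val \in symfun_pred }.

HB.instance Definition _ := [isSub for symfun_val].
HB.instance Definition _ := [Choice of symfun by <:].
HB.instance Definition _ := [SubChoice_isSubComNzRing of symfun by <:].
HB.instance Definition _ := [SubNmodule_isSubLSemiModule of symfun by <:].
HB.instance Definition _ :=
  [SubNzRing_SubLmodule_isSubLalgebra of symfun by <:].
HB.instance Definition _ := [SubLalgebra_isSubAlgebra of symfun by <:].

Lemma smonom_prod (T : Type) (r : seq T) (g : T -> {cmonom I}) :
  smonom (\big[mmul/mone]_(t <- r) g t) = \prod_(t <- r) smonom (g t).
Proof. exact: (big_morph _ smonomM smonom1). Qed.

Lemma relabel_prod s s' (T : Type) (r : seq T) (g : T -> {cmonom I}) :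
  cancel s s' -> cancel s' s ->
  relabel s s' (\big[mmul/mone]_(t <- r) g t) =
  \big[mmul/mone]_(t <- r) relabel s s' (g t).
Proof.
move=> sK s'K.
apply: (big_morph _ (fun m1 m2 => relabelM m1 m2 sK s'K) (relabel1 sK s'K)).
Qed.

Lemma relabelU s s' i : cancel s s' -> cancel s' s ->
  relabel s s' (ucm i) = ucm (s i).
Proof.
move=> sK s'K; apply/eqP/cmP => j; rewrite relabelE// !cmU.
by rewrite -(can2_eq sK s'K).
Qed.

Lemma mdeg_relabel s s' m : cancel s s' -> cancel s' s ->
  mdeg (relabel s s' m) = mdeg m.
Proof.
move=> sK s'K; rewrite !mdegE.
have -> : finsupp (relabel s s' m) = [fset s i | i in finsupp m]%fset.
  apply/fsetP => i; rewrite mem_finsupp relabelE// -mem_finsupp.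
  apply/idP/imfsetP => [s'im|[j jm ->]]; last by rewrite sK.
  by exists (s' i) => //; rewrite s'K.
rewrite big_imfset/=; last by move=> ? ? _ _; apply: (can_inj sK).
by apply: eq_bigr => i _; rewrite relabelE// sK.
Qed.

Lemma ssum_smonom_symfun (T : choiceType) (A : set T) (g : T -> {cmonom I}) d :
  (forall s s', cancel s s' -> cancel s' s ->
    exists2 tau : T -> T, set_bij A A tau &
      forall t, g (tau t) = relabel s s' (g t)) ->
  (forall t, A t -> (mdeg (g t) <= d)%N) ->
  ssum A (fun t => smonom (g t)) \in symfun_pred.
Proof.
move=> gtau gd; apply/asboolP; split.
  apply/perm_invariantP => s s' m sK s'K /=.
  have [tau tauA gt] := gtau _ _ sK s'K.
  rewrite (reindex_fsbig tau A)//; apply: eq_fsbigr => t _.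
  by rewrite /= gt (can_eq (relabelK sK s'K)).
exists d => m Fm; suff [t At ->] : exists2 t, A t & m = g t by apply: gd.
apply: contrapT => N; move/eqP: Fm; apply; apply: fsbig1 => t At /=.
by case: eqVneq => // mt; case: N; exists t.
Qed.

Lemma relabel_bij s s' (A : set {cmonom I}) : cancel s s' -> cancel s' s ->
  (forall s s' m, cancel s s' -> cancel s' s -> A m -> A (relabel s s' m)) ->
  set_bij A A (relabel s s').
Proof.
move=> sK s'K AA; split=> [m Am|m m' _ _|m Am].
- exact: AA.
- exact: (can_inj (relabelK sK s'K)).
by exists (relabel s' s m); [exact: AA|exact: relabelK].
Qed.

Definition elementary_series k : series R I :=
  ssum [set m | mdeg m = k /\ forall i, (m i <= 1)%N] smonom.

Fact elementary_key k : elementary_series k \in symfun_pred.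
Proof.
apply: (@ssum_smonom_symfun _ _ id k) => [s s' sK s'K|m [->]//].
exists (relabel s s') => //; apply: relabel_bij => // {sK s'K}s {}s' m sK s'K.
by case=> mk m1; split=> [|i]; rewrite ?mdeg_relabel// relabelE.
Qed.

Definition elementary k : symfun := SymFun (elementary_key k).

Definition complete_series k : series R I := ssum [set m | mdeg m = k] smonom.

Fact complete_key k : complete_series k \in symfun_pred.
Proof.
apply: (@ssum_smonom_symfun _ _ id k) => [s s' sK s'K|m ->//].
exists (relabel s s') => //; apply: relabel_bij => // {sK s'K}s {}s' m sK s'K.
by move=> /= mk; rewrite mdeg_relabel.
Qed.

Definition complete k : symfun := SymFun (complete_key k).

(* The k-th power sum in the variables svar (c j), j : J; meaningful for k > 0
   (for k = 0 and J infinite the family is not summable). *)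
Definition psum (J : choiceType) (c : J -> I) k : series R I :=
  ssum [set: J] (fun j => svar (c j) ^+ k).

Fact power_sum_key k : psum id k \in symfun_pred.
Proof.
pose g (i : I) : {cmonom I} := \big[mmul/mone]_(j < k) ucm i.
have -> : psum id k = ssum setT (fun i : I => smonom (g i)).
  congr ssum; apply/funext => i; rewrite smonom_prod prodr_const cardT.
  by rewrite size_enum_ord.
apply: (@ssum_smonom_symfun _ _ g k) => [s s' sK s'K|i _].
  exists s; first by rewrite setTT_bijective; exists s'.
  by move=> i; rewrite relabel_prod//; apply: eq_bigr => j _; rewrite relabelU.
rewrite mdeg_prod big_const_ord iter_addn_0 mdegU mul1n//.
Qed.

Definition power_sum k : symfun := SymFun (power_sum_key k).

Definition proper_coloring (T : finType) (e : rel T) (f : {ffun T -> I}) :=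
  forall u v, e u v -> f u != f v.

(* The colors are the indices of the variables. *)
Definition chromatic_series (T : finType) (e : rel T) : series R I :=
  ssum [set f | proper_coloring e f] (fun f => \prod_(v : T) svar (f v)).

Fact chromatic_key (T : finType) (e : rel T) :
  chromatic_series e \in symfun_pred.
Proof.
pose g (f : {ffun T -> I}) := \big[mmul/mone]_(v : T) ucm (f v).
have -> : chromatic_series e =
    ssum [set f | proper_coloring e f] (fun f => smonom (g f)).
  by congr ssum; apply/funext => f; rewrite smonom_prod.
apply: (@ssum_smonom_symfun _ _ g #|T|) => [s s' sK s'K|f _].
  exists (fun f : {ffun T -> I} => [ffun v => s (f v)]); last first.
    move=> f; rewrite relabel_prod//; apply: eq_bigr => v _.
    by rewrite relabelU// ffunE.
  split=> [f ef u v /ef|f f' _ _ /ffunP ff'|f ef].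
  - by rewrite !ffunE (can_eq sK).
  - by apply/ffunP => v; have := ff' v; rewrite !ffunE => /(can_inj sK).
  exists [ffun v => s' (f v)]; last by apply/ffunP => v; rewrite !ffunE s'K.
  by move=> u v /ef; rewrite !ffunE (can_eq s'K).
rewrite mdeg_prod (eq_bigr (fun=> 1%N)) ?sum1_card// => v _; exact: mdegU.
Qed.

Definition chromatic (T : finType) (e : rel T) : symfun :=
  SymFun (chromatic_key e).

End SeriesTheory.

Arguments svar {R I} i.
Arguments psum {R I J} c k.
Arguments elementary {R I} k.
Arguments complete {R I} k.
Arguments power_sum {R I} k.
Arguments chromatic {R I T} e.

Section Orientations.
Context (n : nat).
Local Open Scope nat_scope.
Local Open Scope set_scope.
Implicit Types (e : rel 'I_n) (g : {set 'I_n * 'I_n}) (W U : {set 'I_n}).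

(* An orientation is the set of its arcs. *)
Definition arc g : rel 'I_n := [rel u v | (u, v) \in g].

Definition orientation e g :=
  (forall u v, arc g u v -> e u v) /\
  (forall u v, e u v -> arc g u v (+) arc g v u).

Definition acyclic g := forall c : seq 'I_n, cycle (arc g) c -> c = [::].

Definition no_descent g (f : {ffun 'I_n -> nat}) :=
  forall u v, arc g u v -> f u <= f v.

Definition restrict_arcs W g := [set a in g | (a.1 \in W) && (a.2 \in W)].

Definition reachable g (w : 'I_n) := [set v | connect (arc g) w v].

(* The component following those with union U; in the remaining definitions g
   is an orientation of a graph with vertex set W. *)
Definition next_component W g U : {set 'I_n} :=
  if [pick m in W :\: U | [forall w in W :\: U, m <= w]] is Some m
  then reachable g m :\: U else finset.set0.

Fixpoint components_union W g k : {set 'I_n} :=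
  if k is k'.+1
  then components_union W g k' :|: next_component W g (components_union W g k')
  else finset.set0.

Definition source_component W g k := next_component W g (components_union W g k).

(* The non-empty source-components occur among the first #|W|. *)
Definition source_partition W g : seq nat :=
  sort geq [seq #|source_component W g k|
           | k <- iota 0 #|W| & source_component W g k != finset.set0].

End Orientations.

(* The variables y_1, y_2, ... are indexed by inl 0, inl 1, ... and
   z_1, z_2, ... by inr 0, inr 1, ... *)
Definition yz_series := series rat (nat + nat)%type.

Definition p_y (k : nat) : yz_series := psum inl k.
Definition p_z (k : nat) : yz_series := psum inr k.
Definition p_part_y (la : seq nat) : yz_series := \prod_(k <- la) p_y k.
Definition zvar (i : nat) : yz_series := svar (inr i.-1).

(* Main.v *)
(* Expand X_G in power sums by partitioning V into monochromatic blocks, the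
   block C getting the coefficient (-1)^(|C| - 1) a(C), where a(C) counts the
   acyclic orientations of G[C] in which all of C is reachable from min C.  This
   is the recursion
     [W stable] = sum over min W in C <= W of (-1)^(|C| - 1) a(C) [W \ C stable],
   which holds because an orientation counted by a(C) extends to an acyclic
   orientation of G[W] having W \ C among its sinks, and moving a sink between C
   and W \ C cancels everything when W is not stable.  By Newton's identities
   omega maps p_k to (-1)^(k - 1) p_k, which removes the signs.  Expanding each
   p_k(y) + p_k(z) as a sum over the color of the block, the result counts
   colorings f with a partition into monochromatic blocks and a rooted
   orientation of each block; such a family glues to a unique pair (gamma, f) in
   D, the arcs between blocks being oriented by increasing f and, for equal f,
   by decreasing minimum of the block.  The blocks of color 0 are then the
   source-components of gamma_0.

   Infinite sums of series are reduced to finite ones by the ring morphism that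
   kills all variables outside a finite set. *)

From HB Require Import structures.
Require Import Defs.
From mathcomp Require Import all_boot all_algebra.
From mathcomp Require Import zify.

Set Implicit Arguments.
Unset Strict Implicit.
Unset Printing Implicit Defensive.

Import GRing.Theory.

Local Notation arc := Defs.arc.

(** * Rooted acyclic orientations *)

Section Acyclic.
Context (n : nat).
Implicit Types (e : rel 'I_n) (g : {set 'I_n * 'I_n}) (W C : {set 'I_n}) (x m : 'I_n).

(** Boolean forms of the predicates, so that orientations can be collected in finite sets and
    counted. *)
Definition orientationb e g :=
  [forall u, forall v, (arc g u v ==> e u v) &&
                       (e u v ==> arc g u v (+) arc g v u)].

Definition acyclicb g :=
  [forall u, forall v, arc g u v ==> ~~ connect (arc g) v u].

Lemma orientationP e g : reflect (orientation e g) (orientationb e g).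
Proof.
apply: (iffP 'forall_forallP) => [eg|[ge eg] u v].
  by split=> u v; have /andP[/implyP ? /implyP ?] := eg u v.
by apply/andP; split; apply/implyP; [exact: ge|exact: eg].
Qed.

Lemma acyclicP g : reflect (acyclic g) (acyclicb g).
Proof.
apply: (iffP 'forall_'forall_implyP) => [ag [//|u p]|ag u v uv].
  case: p => [|v p] /=; first by case/andP => /ag; rewrite connect0.
  case/andP => /ag /negP uv vp; case: uv; apply/connectP.
  by exists (rcons p u) => //; rewrite last_rcons.
apply/negP => /connectP[p vp uE].
by have /= := ag (v :: p); rewrite rcons_path vp -uE uv => /(_ isT).
Qed.

Lemma arc_restrict W g u v :
  arc (restrict_arcs W g) u v = [&& arc g u v, u \in W & v \in W].
Proof. by rewrite /arc /= inE. Qed.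

Lemma connect_sub_arc g g' u v :
  g' \subset g -> connect (arc g') u v -> connect (arc g) u v.
Proof.
by move=> /subsetP gg'; apply: connect_sub => x y /gg' xy; apply: connect1.
Qed.

Lemma acyclicb_sub g g' : g' \subset g -> acyclicb g -> acyclicb g'.
Proof.
move=> gg' /'forall_'forall_implyP ag; apply/'forall_'forall_implyP => u v uv.
apply: contra (ag u v (subsetP gg' _ uv)); exact: connect_sub_arc.
Qed.

Lemma restrict_arcs_sub W g : restrict_arcs W g \subset g.
Proof. by apply/subsetP => a; rewrite inE => /andP[]. Qed.

(** Each vertex on a path from [u] to [v] is reachable from [u] and reaches [v], so the hypothesis
    keeps the whole path inside [W]. *)
Lemma connect_restrict W g u v :
  (forall w, connect (arc g) u w -> connect (arc g) w v -> w \in W) ->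
  connect (arc g) u v -> connect (arc (restrict_arcs W g)) u v.
Proof.
move=> + /connectP[p]; elim: p u => [|w p IHp] u /= uW; first by move=> _ ->.
case/andP => uw wp vE; have wv : connect (arc g) w v by apply/connectP; exists p.
apply: (@connect_trans _ _ w); last first.
  by apply: IHp => // x wx; apply: uW; apply: connect_trans wx; apply: connect1.
apply: connect1; rewrite arc_restrict uw !uW//; first exact: connect1.
by apply: connect_trans wv; apply: connect1.
Qed.

Lemma connect_mono (key : 'I_n -> nat) g u v :
  (forall u v, arc g u v -> key u <= key v) ->
  connect (arc g) u v -> key u <= key v.
Proof.
move=> kg /connectP[p + ->]; elim: p u => //= w p IHp u /andP[/kg uw].
by move=> /IHp; apply: leq_trans.
Qed.

Lemma connect_invariant W g u v : (forall u v, arc g u v -> u \in W -> v \in W) ->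
  connect (arc g) u v -> u \in W -> v \in W.
Proof.
move=> gW /connectP[p + ->]; elim: p u => //= w p IHp u /andP[/gW uw wp] uW.
by apply: IHp => //; apply: uw.
Qed.

(** A weakly increasing key is constant along a directed cycle, so any cycle lies in a single level
    set. *)
Lemma acyclicb_key (key : 'I_n -> nat) g :
  (forall u v, arc g u v -> key u <= key v) ->
  (forall u, acyclicb (restrict_arcs [set v | key v == key u] g)) ->
  acyclicb g.
Proof.
move=> kg ag; apply/'forall_'forall_implyP => u v uv; apply/negP => vu.
have kuv : key u = key v.
  by apply/eqP; rewrite eqn_leq (kg _ _ uv) (connect_mono kg vu).
have /'forall_'forall_implyP/(_ u v) := ag u.
rewrite arc_restrict uv !inE kuv eqxx => /(_ isT)/negP; apply.
apply: connect_restrict => // w vw wu; rewrite inE eqn_leq.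
by rewrite (connect_mono kg vw) -kuv (connect_mono kg wu).
Qed.

Definition sink g u := [forall v, ~~ arc g u v].

Lemma connect_sink g u v : sink g u -> connect (arc g) u v -> v = u.
Proof.
by move=> /forallP su /connectP[[|w p] /= + ->] => // /andP[]; rewrite (negbTE (su w)).
Qed.

(** Among the vertices reachable from [u], take one that reaches the fewest vertices. An arc out of
    it would lead to a vertex reaching strictly fewer, by acyclicity. *)
Lemma exists_sink g u : acyclicb g -> exists2 t, sink g t & connect (arc g) u t.
Proof.
move=> /'forall_'forall_implyP ag.
case: (@arg_minnP _ u (connect (arc g) u) (fun t => #|connect (arc g) t|)) => [|t ut tmin].
  exact: connect0.
exists t => //; apply/forallP => v; apply/negP => tv.
have := tmin v (connect_trans ut (connect1 tv)); rewrite leqNgt => /negP; apply.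
apply: proper_card; apply/properP; split.
  by apply/subsetP => x vx; apply: connect_trans vx; apply: connect1.
by exists t; [exact: connect0|exact: ag].
Qed.

Definition induced e W := [rel u v | [&& e u v, u \in W & v \in W]].

Definition stable e W := [forall u in W, forall v in W, ~~ e u v].

Definition rooted_orientations e (x : 'I_n) C :=
  [set g | [&& orientationb (induced e C) g, acyclicb g &
            [forall v in C, (x <= v) && connect (arc g) x v]]].

Lemma rooted_orientationsP e x C g : reflect
  [/\ orientation (induced e C) g, acyclicb g &
      forall v, v \in C -> x <= v /\ connect (arc g) x v]
  (g \in rooted_orientations e x C).
Proof.
rewrite inE; apply: (iffP and3P) => -[/orientationP ? ? H]; split=> //.
  by move=> v vC; apply/andP; apply: (forall_inP H).
by apply/forall_inP => v /H/andP.
Qed.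

Lemma rooted_root e x C g :
  g \in rooted_orientations e x C -> C != set0 -> x \in C.
Proof.
move=> /rooted_orientationsP[[gC _] _ Cx] /set0Pn[v vC].
have [_ /connectP[[|w p] /= + vE]] := Cx v vC; first by rewrite -vE.
by case/andP => /gC/and3P[].
Qed.

Lemma card_rooted0 e x : #|rooted_orientations e x set0| = 1%N.
Proof.
rewrite -(cards1 (set0 : {set 'I_n * 'I_n})); apply: eq_card.
move=> g; apply/rooted_orientationsP/set1P => [[[g0 _] _ _]|->].
  by apply/setP => -[u v]; rewrite inE; apply/idP => /g0/and3P[_]; rewrite inE.
split=> [|| v]; last by rewrite inE.
  by split=> u v; [rewrite /arc /= inE|case/and3P => _; rewrite inE].
by apply/'forall_'forall_implyP => u v; rewrite /arc /= inE.
Qed.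

End Acyclic.

(** * Cancellation by moving a sink *)

Section Deletion.
Context (n : nat) (e : rel 'I_n).
Hypothesis e_sym : symmetric e.
Implicit Types (g : {set 'I_n * 'I_n}) (W C : {set 'I_n}) (x m : 'I_n).

Definition add_sinks W C g :=
  g :|: [set a | [&& e a.1 a.2, a.1 \in C & a.2 \in W :\: C]].

Definition sink_extensions (m : 'I_n) W C :=
  [set g | [&& orientationb (induced e W) g, acyclicb g,
     [forall t in W :\: C, sink g t] & [forall v in C, connect (arc g) m v]]].

(** Adjacent vertices cannot both be sinks, which forces [W :\: C] to be stable. In that case every
    edge not inside [C] must point from [C] to [W :\: C], so an extension is determined by its
    restriction to [C], and [add_sinks] is the inverse of restriction. *)
Lemma card_sink_extensions (m : 'I_n) W C : C \subset W -> m \in C ->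
  (forall w, w \in W -> m <= w) ->
  #|sink_extensions m W C| =
  (stable e (W :\: C) * #|rooted_orientations e m C|)%N.
Proof.
move=> /subsetP CW mC mW.
case: (boolP (stable e (W :\: C))) => [sT|nsT]; last first.
  apply/eqP; rewrite cards_eq0; apply/eqP/setP => g; rewrite [RHS]inE.
  apply: contraNF nsT; rewrite inE => /and4P[/orientationP[_ gW] _ /forall_inP sg _].
  apply/forall_inP => u uT; apply/forall_inP => v vT; apply/negP => uv.
  have : induced e W u v.
    by rewrite /= uv; move: uT vT; rewrite !inE => /andP[_ ->] /andP[_ ->].
  move=> /gW; rewrite (negbTE (forallP (sg u uT) v)).
  by rewrite (negbTE (forallP (sg v vT) u)).
have stT u v : u \in W -> v \in W -> u \notin C -> v \notin C -> e u v = false.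
  move=> uW vW uC vC; apply/negbTE; apply: (forall_inP (forall_inP sT u _) v).
    by rewrite inE uC.
  by rewrite inE vC.
rewrite mul1n.
rewrite -(card_in_imset (f := add_sinks W C) (D := rooted_orientations e m C)); last first.
  move=> g g' /rooted_orientationsP[[gC _] _ _] /rooted_orientationsP[[gC' _] _ _].
  move=> /setP gg'; apply/setP => -[u v]; have := gg' (u, v).
  rewrite !inE /=; case: (boolP (v \in C)) => vC; first by rewrite !andbF !orbF.
  move=> _; have N (h : {set 'I_n * 'I_n}) : (forall u v, arc h u v -> induced e C u v) ->
      (u, v) \in h = false.
    by move=> hC; apply: contraNF vC => /hC/and3P[].
  by rewrite !N.
apply: eq_card => g; apply/idP/imsetP; last first.
  case=> h /rooted_orientationsP[[hC Ch] ah hm] ->.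
  have addE u v : arc (add_sinks W C h) u v =
      arc h u v || [&& e u v, u \in C, v \notin C & v \in W].
    by rewrite /arc /= !inE.
  rewrite inE; apply/and4P; split.
  - apply/orientationP; split=> u v.
      rewrite addE => /orP[/hC/and3P[/= -> /CW-> /CW->]//|].
      by case/and4P => /= -> /CW-> _ ->.
    rewrite !addE (e_sym v u) => /and3P[uv uW vW]; rewrite uv uW vW !andbT /=.
    have hF x y : ~~ ((x \in C) && (y \in C)) -> arc h x y = false.
      by apply: contraNF => /hC/and3P[_ -> ->].
    case: (boolP (u \in C)) => uC; case: (boolP (v \in C)) => vC.
    + by rewrite !orbF; apply: Ch; rewrite /= uv uC.
    + by rewrite !hF ?(negbTE vC) ?andbF.
    + by rewrite !hF ?(negbTE uC) ?andbF.
    + by rewrite stT in uv.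
  (* The key is 0 on [C] and 1 outside: no arc returns to [C], and no arc joins two vertices outside
     [C]. *)
  - apply: (@acyclicb_key _ (fun v => v \notin C)) => [u v|u].
      by rewrite addE => /orP[/hC/and3P[_ -> ->]//|/and4P[_ -> ->]].
    apply: acyclicb_sub ah; apply/subsetP => -[v w].
    rewrite !inE /= => /and3P[/orP[//|/and4P[_ vC wC _]]].
    by rewrite vC wC; case: (u \notin C).
  - apply/forall_inP => t; rewrite inE => /andP[tC _]; apply/forallP => v.
    by rewrite addE (negbTE tC) andbF orbF; apply: contra tC => /hC/and3P[].
  - apply/forall_inP => v /hm[_]; apply: connect_sub_arc; exact: subsetUl.
rewrite inE => /and4P[/orientationP[gW Wg] ag /forall_inP gT /forall_inP gC].
have gS u v : arc g u v -> u \in C.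
  move=> uv; have /and3P[_ uW _] := gW _ _ uv; apply: contraTT uv => uC.
  have su : sink g u by apply: gT; rewrite inE uC.
  exact: (forallP su v).
exists (restrict_arcs C g).
  apply/rooted_orientationsP; split.
  - split=> u v; rewrite !arc_restrict; first by case/and3P => /gW/and3P[/= -> _ _] -> ->.
    by case/and3P => uv uC vC; rewrite uC vC !andbT; apply: Wg; rewrite /= uv !CW.
  - by apply: acyclicb_sub ag; exact: restrict_arcs_sub.
  - move=> v vC; split; first by apply: mW; apply: CW.
    (* Only vertices of [C] have outgoing arcs, so a path ending in [C] never leaves it. *)
    apply: connect_restrict; last exact: gC.
    move=> w _ /connectP[[|x p] /= + vE]; first by rewrite -vE.
    by case/andP => /gS.
apply/setP => -[u v]; rewrite !inE /=; apply/idP/idP => [uv|].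
  have /and3P[euv uW vW] := gW _ _ uv.
  by rewrite uv euv vW (gS _ _ uv); case: (v \in C).
case/orP => [/andP[]//|/and4P[uv uC vC vW]].
have : induced e W u v by rewrite /= uv CW.
move/Wg; rewrite -[(u, v) \in g]/(arc g u v); case: (arc g u v) => //= /gS.
by rewrite (negbTE vC).
Qed.

(* When W is not stable, toggling the membership in C of a sink that is
   reachable from m and different from m cancels all the terms. *)
Lemma stable_rooted (R : comNzRingType) (m : 'I_n) W : m \in W ->
  (forall w, w \in W -> m <= w) ->
  ((stable e W)%:R = \sum_(C : {set 'I_n} | (C \subset W) && (m \in C))
     (-1) ^+ #|C|.-1 * #|rooted_orientations e m C|%:R *
     (stable e (W :\: C))%:R :> R)%R.
Proof.
move=> mW mmin.
(* Summing over the orientation first leaves, for each fixed [g], a signed count of the sets [C] it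
   extends. *)
transitivity (\sum_(g : {set 'I_n * 'I_n}) \sum_(C : {set 'I_n} |
    [&& C \subset W, m \in C & g \in sink_extensions m W C])
    (-1) ^+ #|C|.-1 : R)%R; last first.
  rewrite (exchange_big_dep (fun C : {set 'I_n} => (C \subset W) && (m \in C)))/=;
    last by move=> g C _ /and3P[-> ->].
  apply: eq_bigr => C /andP[CW mC]; rewrite -mulrA -natrM mulnC.
  rewrite -card_sink_extensions// CW mC /= sumr_const.
  by rewrite mulr_natr.
(* If [W] is stable, only the empty orientation occurs, and then reachability from [m] forces [C] to
   be [[set m]]. *)
case: (boolP (stable e W)) => [sW|nsW].
  rewrite (bigD1 (set0 : {set 'I_n * 'I_n}))//= (bigD1 [set m]) /=; last first.
    rewrite sub1set mW set11 inE /=; apply/and4P; split.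
    - apply/orientationP; split=> u v; rewrite /arc /= !inE//.
      case/and3P => uv uW vW.
      by rewrite (negbTE (forall_inP (forall_inP sW _ uW) _ vW)) in uv.
    - by apply/'forall_'forall_implyP => u v; rewrite /arc /= inE.
    - by apply/forall_inP => t _; apply/forallP => v; rewrite /arc /= inE.
    - by apply/forall_inP => v; rewrite inE => /eqP ->; rewrite connect0.
  rewrite cards1 expr0 big1 ?addr0; last first.
    move=> C /andP[/and3P[CW mC]]; rewrite inE => /and4P[_ _ _ /forall_inP Cm].
    case/negP; rewrite eqEsubset sub1set mC andbT; apply/subsetP => v /Cm vm.
    rewrite inE; apply/eqP; apply: connect_sink vm.
    by apply/forallP => w; rewrite /arc /= inE.
  rewrite big1 ?addr0// => g /set0Pn[[u v] uv]; rewrite big1// => C.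
  case/and3P => _ _; rewrite inE => /and4P[/orientationP[/(_ u v uv)/and3P[+ uW vW]]].
  by rewrite (negbTE (forall_inP (forall_inP sW _ uW) _ vW)).
rewrite big1// => g _.
case: (boolP (orientationb (induced e W) g && acyclicb g)) => [/andP[og ag]|noag];
  last first.
  rewrite big_pred0// => C; apply: contraNF noag => /and3P[_ _].
  by rewrite inE => /and4P[-> ->].
have [gW Wg] := orientationP _ _ og.
(* The sink [t] depends on [g] alone and not on [C], so toggling it is an involution. If [t] is [m],
   then any admissible [C] would be [[set m]] and all of [W] would consist of sinks, contradicting
   that [W] is not stable. *)
have [t st mt] := exists_sink m ag; have [tm|tm] := eqVneq t m.
  rewrite big_pred0// => C; apply: contraNF nsW => /and3P[CW mC].
  rewrite inE => /and4P[_ _ /forall_inP sg /forall_inP gC].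
  have sW u : u \in W -> sink g u.
    move=> uW; case: (boolP (u \in C)) => uC; last by apply: sg; rewrite inE uC.
    by rewrite tm in st; rewrite (connect_sink st (gC u uC)).
  apply/forall_inP => u uW; apply/forall_inP => v vW; apply/negP => uv.
  have := Wg u v; rewrite /= uv uW vW => /(_ isT).
  by rewrite (negbTE (forallP (sW _ uW) v)) (negbTE (forallP (sW _ vW) u)).
have tW : t \in W.
  apply: (connect_invariant _ mt mW) => u v /gW/and3P[] //.
(* Both conditions on [C] ignore [t]: it is a sink and it is reachable from [m], hence allowed on
   either side. The two sets differ in size by one, so their signs cancel. *)
have toggle C : t \notin C ->
    [&& t |: C \subset W, m \in t |: C & g \in sink_extensions m W (t |: C)] =
    [&& C \subset W, m \in C & g \in sink_extensions m W C].
  move=> tC; rewrite subUset sub1set tW !inE eq_sym (negbTE tm) og ag /=.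
  congr [&& _, _ & _ && _].
    apply/forall_inP/forall_inP => sC w.
      rewrite inE => /andP[wC wW]; have [->//|wt] := eqVneq w t.
      by apply: sC; rewrite !inE negb_or wt wC.
    by rewrite !inE negb_or -andbA => /and3P[_ wC wW]; apply: sC; rewrite inE wC.
  apply/forall_inP/forall_inP => cC w wC; first by apply: cC; rewrite inE wC orbT.
  by case/setU1P: wC => [->//|/cC].
rewrite (bigID (fun C : {set 'I_n} => t \in C))/=.
rewrite (reindex_onto (fun C => t |: C) (fun C => C :\ t))/=; last first.
  by move=> C /andP[_ tC]; rewrite setD1K.
rewrite big_mkcond [X in (_ + X)%R]big_mkcond -big_split big1//= => C _.
have [tC|tC] := boolP (t \in C).
  rewrite andbF (_ : _ == C = false) ?andbF ?addr0//.
  by apply/eqP => CE; move: tC; rewrite -CE !inE eqxx.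
rewrite toggle// setU11 setU1K// eqxx !andbT; case: ifP => [/and3P[_ mC _]|]; last first.
  by rewrite addr0.
by rewrite cardsU1 tC (cardsD1 m) mC add1n addrC /= exprS mulN1r subrr.
Qed.

End Deletion.

(** * Stability as a signed sum over partitions into blocks *)

Section Inversion.
Context (n : nat) (R : comNzRingType).
Implicit Types (e : rel 'I_n) (g : {set 'I_n * 'I_n}) (W C : {set 'I_n}).
Implicit Types (x m v : 'I_n).
Local Open Scope ring_scope.

Definition signed_rooted e x C : R :=
  (-1) ^+ #|C|.-1 * #|rooted_orientations e x C|%:R.

Lemma card_rooted_eq0 e x C v : v \in C -> ~~ ((x \in C) && (x <= v)%N) ->
  #|rooted_orientations e x C| = 0%N.
Proof.
move=> vC; apply: contraNeq; rewrite -lt0n card_gt0 => /set0Pn[g gC].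
rewrite (rooted_root gC); last by apply/set0Pn; exists v.
by have /rooted_orientationsP[_ _ /(_ v vC)[]] := gC.
Qed.

Lemma signed_rooted0 e x : signed_rooted e x set0 = 1.
Proof. by rewrite /signed_rooted cards0 card_rooted0 mulr1. Qed.

Lemma signed_rooted_eq0 e x C v : v \in C -> ~~ ((x \in C) && (x <= v)%N) ->
  signed_rooted e x C = 0.
Proof. by move=> vC /(card_rooted_eq0 e vC) C0; rewrite /signed_rooted C0 mulr0. Qed.

(** Encodes a partition of [W]: a vertex is sent to the label of its block, and to [None] outside
    [W]. A block whose label is not its least element is not excluded here, but it gets weight 0
    from [signed_rooted]. *)
Definition labels_on W (r : {ffun 'I_n -> option 'I_n}) :=
  [forall v, (r v == None) == (v \notin W)].

Lemma labels_onP W (r : {ffun 'I_n -> option 'I_n}) :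
  reflect (forall v, (r v == None) = (v \notin W)) (labels_on W r).
Proof. by apply: (iffP forallP) => H v; [exact: (eqP (H v))|rewrite H eqxx]. Qed.

(** Iteration of [stable_rooted]: split off the block [C] of the least element of [W] and apply
    induction to [W :\: C]. *)
Lemma stable_labels e W : symmetric e ->
  (stable e W)%:R = \sum_(r | labels_on W r)
     \prod_x signed_rooted e x [set v | r v == Some x].
Proof.
move=> e_sym; have [k] := ubnP #|W|; elim: k => // k IHk in W * => Wk.
have [->|/set0Pn[w wW]] := eqVneq W set0.
  rewrite (big_pred1 [ffun=> None]) => [|r]; last first.
    apply/labels_onP/eqP => [r0|-> v]; last by rewrite ffunE inE eqxx.
    by apply/ffunP => v; rewrite ffunE; apply/eqP; rewrite r0 inE.
  rewrite big1 => [|x _].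
    by case: (boolP (stable _ _)) => // /negP[]; apply/forall_inP => u; rewrite inE.
  rewrite (_ : [set v | _] = set0) ?signed_rooted0//.
  by apply/setP => v; rewrite !inE ffunE.
have [m mW mmin] : exists2 m, m \in W & forall v, v \in W -> (m <= v)%N.
  by case: (@arg_minnP _ w (mem W) (@nat_of_ord n)) => // m mW mmin; exists m.
rewrite (stable_rooted e_sym R mW mmin).
(* Labellings are grouped by the fibre [C] of the label [m]. *)
rewrite (partition_big (fun r : {ffun 'I_n -> option 'I_n} =>
  [set v | r v == Some m]) predT)//= big_mkcond; apply: eq_bigr => C _.
case: ifPn => [/andP[CW mC]|CWm]; last first.
  apply/esym/big1 => r /andP[/labels_onP rW /eqP rC].
  have CW : C \subset W.
    apply/subsetP => v; rewrite -rC inE => /eqP rv; apply: contraTT isT => vW.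
    by have := rW v; rewrite vW rv.
  rewrite CW /= in CWm.
  have := rW m; rewrite mW; case rm : (r m) => [x|] // _.
  have xm : x != m by apply: contraNneq CWm => xm; rewrite -rC inE rm xm.
  rewrite (bigD1 x)//= (@signed_rooted_eq0 _ _ _ m) ?mul0r//; first by rewrite inE rm.
  apply: contraNN xm => /andP[]; rewrite inE => /eqP rx xm.
  apply/eqP/val_inj/eqP; rewrite eqn_leq xm mmin//.
  by have := rW x; rewrite rx; case: (x \in W).
rewrite IHk; last first.
  rewrite -ltnS; apply: leq_trans Wk; rewrite ltnS; apply: proper_card; apply/properP.
  by split; [exact: subsetDl|exists m; rewrite // inE mC].
(* A labelling of [W :\: C] that uses [m] as a label has weight 0, because [m] is not in [W :\: C].
   The label is thus free to be given to [C]. *)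
rewrite (bigID (fun r : {ffun 'I_n -> option 'I_n} => [set v | r v == Some m] == set0))/=.
rewrite [X in _ * (_ + X)]big1 ?addr0 => [|r /andP[/labels_onP rW /set0Pn[v rv]]]; last first.
  rewrite (bigD1 m)//= (@signed_rooted_eq0 _ _ _ v) ?mul0r//.
  rewrite inE; have := rW m; rewrite !inE mC /= => /eqP ->.
  by [].
pose h (r : {ffun 'I_n -> option 'I_n}) := [ffun v => if v \in C then Some m else r v].
pose h' (r : {ffun 'I_n -> option 'I_n}) := [ffun v => if v \in C then None else r v].
rewrite [RHS](reindex_onto h h') => [|r /andP[/labels_onP rW /eqP rC]]; last first.
  apply/ffunP => v; rewrite !ffunE; case: (boolP (v \in C)) => //.
  by rewrite -rC inE => /eqP.
rewrite mulr_sumr; apply: eq_big => [r|r /andP[/labels_onP rW /eqP r0]]; last first.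
  rewrite [RHS](bigD1 m)//= [in LHS](bigD1 m)//= r0 signed_rooted0 mul1r.
  congr (_ * _).
    congr signed_rooted; apply/setP => v; rewrite inE ffunE.
    by case: ifP; rewrite ?eqxx//; move/setP/(_ v): r0; rewrite !inE.
  apply: eq_bigr => x xm; congr signed_rooted; apply/setP => v; rewrite !inE ffunE.
  case: ifP => // vC; have := rW v; rewrite !inE vC /= => /eqP ->.
  by apply/esym/eqP => -[mx]; rewrite mx eqxx in xm.
apply/andP/andP => [[/labels_onP rW /eqP r0]|[/andP[/labels_onP rW /eqP rC] /eqP rh]].
  split; last first.
    apply/eqP/ffunP => v; rewrite !ffunE; case: (boolP (v \in C)) => // vC.
    by have := rW v; rewrite !inE vC /= => /eqP ->.
  apply/andP; split.
    apply/labels_onP => v; rewrite ffunE; case: ifP => vC.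
      by rewrite (subsetP CW _ vC).
    by rewrite rW !inE vC.
  apply/eqP/setP => v; rewrite inE ffunE; case: ifP; rewrite ?eqxx// => vC.
  by move/setP/(_ v): r0; rewrite !inE.
have rE v : v \in C -> r v = None by move=> vC; rewrite -rh !ffunE vC.
split.
  apply/labels_onP => v; rewrite !inE; case: (boolP (v \in C)) => vC /=.
    by rewrite rE.
  by have := rW v; rewrite ffunE (negbTE vC).
apply/eqP/setP => v; rewrite !inE; have [vC|vC] := boolP (v \in C).
  by rewrite rE.
by move/setP/(_ v): rC; rewrite inE ffunE (negbTE vC).
Qed.

Lemma stable_partitions e : symmetric e ->
  (stable e setT)%:R = \sum_(r : {ffun 'I_n -> 'I_n})
     \prod_x signed_rooted e x [set v | r v == x].
Proof.
move=> /stable_labels ->.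
rewrite (reindex_onto (fun r : {ffun 'I_n -> 'I_n} => [ffun v => Some (r v)])
  (fun r : {ffun 'I_n -> option 'I_n} => [ffun v => odflt v (r v)])) /=; last first.
  move=> r /labels_onP rT; apply/ffunP => v; rewrite !ffunE.
  by have := rT v; rewrite inE; case: (r v).
apply: eq_big => [r|r _].
  rewrite (_ : _ == _); last by apply/eqP/ffunP => v; rewrite !ffunE.
  by rewrite andbT; apply/labels_onP => v; rewrite ffunE inE.
apply: eq_bigr => x _; congr signed_rooted; apply/setP => v.
by rewrite !inE ffunE.
Qed.

Lemma rooted_monochromatic (T : eqType) e (f : 'I_n -> T) x C :
  (forall v, v \in C -> f v = f x) ->
  rooted_orientations [rel u v | e u v && (f u == f v)] x C =
  rooted_orientations e x C.
Proof.
move=> fC; apply/setP => g.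
have eE u v : induced [rel u v | e u v && (f u == f v)] C u v = induced e C u v.
  rewrite /=; case: (boolP (u \in C)) => [/fC ->|]; last by rewrite !andbF.
  by case: (boolP (v \in C)) => [/fC ->|]; rewrite ?andbF// eqxx !andbT.
rewrite !inE; congr (_ && _); apply: eq_forallb => u; apply: eq_forallb => v.
by have := eE u v; rewrite /= => ->.
Qed.

(* Only partitions into monochromatic blocks contribute: a graph whose edges
   are monochromatic has no rooted orientation of any other block. *)
Lemma proper_partitions (T : eqType) e (f : 'I_n -> T) : symmetric e ->
  [forall u, forall v, e u v ==> (f u != f v)]%:R =
  \sum_(r : {ffun 'I_n -> 'I_n} | [forall v, f (r v) == f v])
     \prod_x signed_rooted e x [set v | r v == x].
Proof.
(* The coloring is proper exactly when the graph [e'] of monochromatic edges has no edge, so the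
   expansion of stability is applied to [e']. *)
move=> e_sym; pose e' : rel 'I_n := [rel u v | e u v && (f u == f v)].
have e'_sym : symmetric e' by move=> u v; rewrite /e' /= e_sym eq_sym.
have -> : [forall u, forall v, e u v ==> (f u != f v)] = stable e' setT.
  apply/'forall_'forall_implyP/forall_inP => H u => [_|v uv].
    by apply/forall_inP => v _; rewrite /e' /= negb_and -implybE; apply/implyP/H.
  by have /forall_inP/(_ v (in_setT v)) := H u (in_setT u); rewrite /e' /= uv.
rewrite stable_partitions// [RHS]big_mkcond; apply: eq_bigr => r _.
case: ifPn => [/forallP fr|].
  apply: eq_bigr => x _; rewrite /signed_rooted rooted_monochromatic// => v.
  by rewrite inE => /eqP <-; rewrite (eqP (fr v)).
rewrite negb_forall => /existsP[v fv]; rewrite (bigD1 (r v))//= /signed_rooted.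
rewrite (_ : #|rooted_orientations _ _ _| = 0%N) ?mulr0 ?mul0r//.
apply/eqP; rewrite cards_eq0; apply/eqP/setP => g; rewrite [RHS]inE; apply/negP.
case/rooted_orientationsP => -[ge _] _ /(_ v); rewrite inE eqxx => /(_ isT)[_ rv].
(* Paths in [e'] preserve the color, so [r v] cannot reach a vertex [v] of another color. *)
suff: v \in [set w | f w == f (r v)] by rewrite inE eq_sym (negbTE fv).
apply: (connect_invariant _ rv) => [u w /ge/and3P[/andP[_ /eqP uw] _ _]|].
  by rewrite !inE uw.
by rewrite inE.
Qed.

End Inversion.

(** * Gluing and source-components *)

Section Roots.
Context (n : nat) (e : rel 'I_n) (f : {ffun 'I_n -> nat}).
Hypothesis e_sym : symmetric e.
Implicit Types (g : {set 'I_n * 'I_n}) (W C : {set 'I_n}) (x u v : 'I_n).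
Implicit Types (r : {ffun 'I_n -> 'I_n}).

Definition compatible :=
  [set g | [&& orientationb e g, acyclicb g &
            [forall u, forall v, arc g u v ==> (f u <= f v)]]].

Lemma compatibleP g : reflect [/\ orientation e g, acyclic g & no_descent g f]
  (g \in compatible).
Proof.
rewrite inE; apply: (iffP and3P) => -[/orientationP ? /acyclicP ? H]; split=> //.
  by move=> u v; apply/implyP; apply: (forallP (forallP H u)).
by apply/'forall_'forall_implyP.
Qed.

(* The source-components of the restrictions of g to the color classes of f are
   the fibres of this map. *)
Definition root_map g : {ffun 'I_n -> 'I_n} :=
  [ffun v => [arg min_(u < v | (f u == f v) && connect (arc g) u v) val u]].

Lemma root_mapP g v : [/\ f (root_map g v) = f v,
  connect (arc g) (root_map g v) v &
  forall u, f u = f v -> connect (arc g) u v -> root_map g v <= u].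
Proof.
rewrite ffunE; case: arg_minnP => [|x /andP[/eqP fx xv] xmin].
  by rewrite eqxx connect0.
by split=> // u fu uv; apply: xmin; rewrite fu eqxx.
Qed.

Lemma root_map_le g v : root_map g v <= v.
Proof. by have [_ _] := root_mapP g v; apply => //; exact: connect0. Qed.

Lemma root_mapK g v : root_map g (root_map g v) = root_map g v.
Proof.
apply/val_inj/eqP; rewrite eqn_leq root_map_le /=.
have [fv rv vmin] := root_mapP g v; have [frv rrv _] := root_mapP g (root_map g v).
by apply: vmin; [rewrite frv|exact: connect_trans rv].
Qed.

(** Every vertex reaching [u] also reaches [v], so the minimum for [v] is taken over a larger
    set. *)
Lemma root_map_anti g u v : f u = f v -> connect (arc g) u v ->
  root_map g v <= root_map g u.
Proof.
move=> fuv uv; have [_ _] := root_mapP g v; have [fu ru _] := root_mapP g u.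
by apply; [rewrite fu|exact: connect_trans uv].
Qed.

Definition fibre r x := [set v | r v == x].

Definition glue r (h : {ffun 'I_n -> {set 'I_n * 'I_n}}) :=
  [set a | e a.1 a.2 && (if r a.1 == r a.2 then a \in h (r a.1) else
            (f a.1 < f a.2) || (f a.1 == f a.2) && (r a.2 < r a.1))].

Definition cut r g : {ffun 'I_n -> {set 'I_n * 'I_n}} :=
  [ffun x => restrict_arcs (fibre r x) g].

Lemma cutE r g x : cut r g x = restrict_arcs (fibre r x) g.
Proof. by rewrite ffunE. Qed.

Definition rooted_family r :=
  family (fun x => mem (rooted_orientations e x (fibre r x))).

(** The lexicographic order by increasing color, then decreasing label, as one number: [n - r v] is
    below the base [n.+1]. *)
Let key r v := f v * n.+1 + (n - r v).

Let key_le r u v :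
  (key r u <= key r v) = (f u < f v) || (f u == f v) && (r v <= r u).
Proof.
rewrite /key; have := ltn_ord (r u); have := ltn_ord (r v).
by case: (ltngtP (f u) (f v)) => /= [H|H|->]; [nia|nia|lia].
Qed.

Let key_inj r u v : key r u = key r v -> f u = f v /\ r u = r v.
Proof.
move=> uv; have := key_le r u v; have := key_le r v u; rewrite uv !leqnn.
case: (ltngtP (f u) (f v)) => //= fuv /esym rvu /esym ruv; split=> //.
by apply/val_inj/eqP; rewrite eqn_leq rvu ruv.
Qed.

Lemma cut_glue r h : h \in rooted_family r -> cut r (glue r h) = h.
Proof.
move=> /familyP hr; apply/ffunP => x; rewrite ffunE; apply/setP => -[u v].
rewrite !inE /=; have /rooted_orientationsP[[hx _] _ _] := hr x.
apply/idP/idP => [/and3P[/andP[_ +] /eqP ru /eqP rv]|uv].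
  by rewrite ru rv eqxx.
have /and3P[uve] := hx _ _ uv; rewrite !inE => /eqP ru /eqP rv.
by rewrite uve ru rv !eqxx uv.
Qed.

(** Glued arcs weakly increase [key], whose level sets are the blocks, and each block is acyclic. A
    vertex [u] of the same color that reaches [v] therefore satisfies [r v <= r u <= u], while [r v]
    itself reaches [v] inside its block, so [r v] is the root of [v]. *)
Lemma glue_compatible r h : (forall v, f (r v) = f v) ->
  h \in rooted_family r -> glue r h \in compatible /\ root_map (glue r h) = r.
Proof.
move=> fr /familyP hr.
have hrP x : [/\ orientation (induced e (fibre r x)) (h x), acyclicb (h x) &
    forall v, v \in fibre r x -> x <= v /\ connect (arc (h x)) x v].
  exact/rooted_orientationsP/hr.
have gkey u v : arc (glue r h) u v -> key r u <= key r v.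
  rewrite /arc /= inE key_le => /andP[_] /=; case: eqP => [ruv _|_].
    by rewrite -(fr u) -(fr v) ruv eqxx leqnn orbT.
  by case/orP => [->//|/andP[-> /ltnW ->]]; rewrite orbT.
have rle v : r v <= v by have [_ _ /(_ v)[]] := hrP (r v); rewrite ?inE.
have hg x : h x \subset glue r h.
  apply/subsetP => -[u v] uv; have [[/(_ _ _ uv)/and3P[uve] + + _] _ _] := hrP x.
  by rewrite !inE /= uve => /eqP -> /eqP ->; rewrite eqxx.
split.
  rewrite inE; apply/and3P; split.
  - apply/orientationP; split=> u v; first by rewrite /arc /= inE => /andP[].
    rewrite /arc /= !inE /= e_sym => uv; rewrite uv /=.
    rewrite [r v == r u]eq_sym; case: eqP => [ruv|/eqP ruv].
      have [[_ hx] _ _] := hrP (r u); rewrite -ruv; apply: hx.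
      by rewrite /= e_sym uv !inE ruv eqxx.
    by case: ltngtP => //= _; move: ruv; rewrite -val_eqE /=; case: ltngtP.
  - apply: (acyclicb_key gkey) => u; have [_ hu _] := hrP (r u).
    apply: acyclicb_sub hu; apply/subsetP => -[v w]; rewrite !inE /=.
    case/and3P => /andP[_ +] /eqP/key_inj[_ vu] /eqP/key_inj[_ wu].
    by rewrite vu wu eqxx.
  - apply/'forall_'forall_implyP => u v /gkey; rewrite key_le.
    by case/orP => [/ltnW|/andP[/eqP ->]].
apply/ffunP => v; have [fv rv vmin] := root_mapP (glue r h) v.
apply/val_inj/eqP; rewrite eqn_leq vmin//=; last first.
  by have [_ _ /(_ v)[]] := hrP (r v); rewrite ?inE// => _; exact: connect_sub_arc.
apply: leq_trans (rle _).
by have := connect_mono gkey rv; rewrite key_le fv ltnn eqxx.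
Qed.

(** A path from the root of [v] to [v] keeps the color, since [f] is weakly increasing along it. By
    [root_map_anti] it also keeps the root, so it stays in the fibre. *)
Lemma cut_rooted g : g \in compatible -> cut (root_map g) g \in rooted_family (root_map g).
Proof.
rewrite inE => /and3P[/orientationP[ge eg] ag /'forall_'forall_implyP fg].
apply/familyP => x; rewrite ffunE; apply/rooted_orientationsP; split.
- split=> u v; rewrite !arc_restrict; first by case/and3P => /ge /= -> -> ->.
  by case/and3P => uv uC vC; rewrite uC vC !andbT; apply: eg.
- by apply: acyclicb_sub ag; exact: restrict_arcs_sub.
move=> v; rewrite inE => /eqP vx; rewrite -vx; split; first exact: root_map_le.
have [fv rv _] := root_mapP g v; apply: connect_restrict => // w xw wv.
have fw : f w = f v.
  by apply/eqP; rewrite eqn_leq (connect_mono fg wv) -fv (connect_mono fg xw).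
rewrite inE; apply/eqP/val_inj/eqP; rewrite eqn_leq (root_map_anti fw wv) andbT.
by rewrite -[X in _ <= val X]root_mapK root_map_anti// fv.
Qed.

(** An arc between different fibres increases the color or, at equal color, strictly decreases the
    root by [root_map_anti]. Its direction is thus the one prescribed by [glue]. *)
Lemma glue_cut g : g \in compatible -> glue (root_map g) (cut (root_map g) g) = g.
Proof.
rewrite inE => /and3P[/orientationP[ge eg] ag /'forall_'forall_implyP fg].
have gle u v : arc g u v ->
    (f u < f v) || (f u == f v) && (root_map g v <= root_map g u).
  move=> uv; have := fg _ _ uv; rewrite leq_eqVlt => /orP[/eqP fuv|->//].
  by rewrite fuv eqxx ltnn root_map_anti//; exact: connect1.
apply/setP => -[u v]; rewrite !inE /=; apply/andP/idP => [[uv]|uv].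
  rewrite cutE; case: eqP => [ruv|ruv]; first by rewrite !inE /= => /andP[].
  move=> uvk; have := eg _ _ uv; case: (boolP (arc g u v)) => //= _ /gle.
  by move: uvk; case: ltngtP => //= _; rewrite ltnNge => /negbTE ->.
split; first exact: ge.
case: eqP => [ruv|/eqP ruv]; first by rewrite cutE !inE /= uv ruv eqxx.
have := gle _ _ uv; rewrite [_ <= root_map g u]leq_eqVlt.
by rewrite val_eqE [root_map g v == _]eq_sym (negbTE ruv).
Qed.

Lemma card_compatible_root r : (forall v, f (r v) = f v) ->
  #|[set g in compatible | root_map g == r]| =
  \prod_x #|rooted_orientations e x (fibre r x)|.
Proof.
move=> fr; transitivity #|rooted_family r|; last first.
  by rewrite card_family foldrE big_map enumT.
rewrite -(card_in_imset (f := glue r) (D := rooted_family r)); last first.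
  by move=> h h' hr hr' hh'; rewrite -(cut_glue hr) -(cut_glue hr') hh'.
apply: eq_card => g; rewrite inE; apply/andP/imsetP => [[gc /eqP <-]|[h hr ->]].
  by exists (cut (root_map g) g); [exact: cut_rooted|rewrite glue_cut].
by have [-> ->] := glue_compatible fr hr.
Qed.

Lemma sum_compatible (R : comNzRingType) (F : {ffun 'I_n -> 'I_n} -> R) :
  (\sum_(g in compatible) F (root_map g) =
  \sum_(r : {ffun 'I_n -> 'I_n} | [forall v, f (r v) == f v])
    (\prod_x #|rooted_orientations e x (fibre r x)|)%:R * F r)%R.
Proof.
rewrite (partition_big root_map (fun r : {ffun 'I_n -> 'I_n} =>
  [forall v, f (r v) == f v])) /=; last first.
  by move=> g _; apply/forallP => v; have [-> _ _] := root_mapP g v.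
apply: eq_bigr => r /forallP fr.
rewrite (eq_bigr (fun=> F r)) => [|g /andP[_ /eqP ->]//].
rewrite -card_compatible_root => [|v]; last exact/eqP.
rewrite mulr_natl -sumr_const; apply: eq_bigl => g.
by rewrite [in RHS]inE.
Qed.

End Roots.

(** * Source-components as fibres of the root map *)

Section SourceComponents.
Context (n : nat) (g : {set 'I_n * 'I_n}) (f : {ffun 'I_n -> nat}).
Hypothesis fg : no_descent g f.
Let W := [set v | f v == 0].
Let gW := restrict_arcs W g.
Let rho := root_map f g.

Let reachE w v : w \in W -> (v \in reachable gW w) = (v \in W) && connect (arc g) w v.
Proof.
move=> wW; rewrite inE; apply/idP/andP => [wv|[vW wv]].
  split; last by apply: connect_sub_arc wv; exact: restrict_arcs_sub.
  by apply: (connect_invariant _ wv) => // u x; rewrite arc_restrict => /and3P[].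
apply: connect_restrict wv => u _ uv.
by move: vW (connect_mono fg uv); rewrite !inE => /eqP ->; rewrite leqn0.
Qed.

Let rhoW v : (rho v \in W) = (v \in W).
Proof. by rewrite !inE; have [-> _ _] := root_mapP f g v. Qed.

(** Invariant of the recursion: the vertices already used are those of [W] with root below a
    threshold [t]. The least remaining vertex [m] is its own root. What it reaches has root at most
    [m], and what remains has root at least [m], so the new component is the fibre of [m] and the
    threshold becomes [m.+1]. *)
Let next_componentP (t : nat) (U := [set v in W | rho v < t]) :
  (exists m, [/\ m \in W, rho m = m, t <= m, next_component W gW U = fibre rho m &
     U :|: next_component W gW U = [set v in W | rho v < m.+1]]) \/
  W = U /\ next_component W gW U = set0.
Proof.
rewrite /next_component; case: pickP => [m /andP[mWU /forall_inP mmin]|noM]; last first.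
  right; split=> //; apply/eqP; rewrite eqEsubset andbC; apply/andP; split.
    by apply/subsetP => v; rewrite inE => /andP[].
  rewrite -setD_eq0; apply: contraT => /set0Pn[v vWU].
  have [m mWU mmin] := arg_minnP (@nat_of_ord n) vWU.
  by have /negP[] := negbT (noM m); apply/andP; split=> //; exact/forall_inP.
have memWU v : (v \in W :\: U) = (v \in W) && (t <= rho v).
  by rewrite /U !inE; case: (f v == 0); rewrite ?andbF//= andbT -leqNgt.
have {}mmin v : v \in W -> t <= rho v -> m <= v.
  by move=> vW tv; apply: mmin; rewrite memWU vW.
move: mWU; rewrite memWU => /andP[mW tm].
have rm : rho m = m.
  apply/val_inj/eqP; rewrite eqn_leq root_map_le mmin ?rhoW//.
  by rewrite /rho root_mapK.
rewrite rm in tm; have mroot v : v \in W -> t <= rho v -> m <= rho v.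
  by move=> vW tv; apply: mmin; rewrite ?rhoW// /rho root_mapK.
left; exists m; have -> : reachable gW m :\: U = fibre rho m.
  apply/setP => v; rewrite inE reachE// [RHS]inE; apply/idP/eqP => [|rv].
    case/and3P => vU vW mv; have tv : t <= rho v.
      by have := memWU v; rewrite inE vU vW.
    apply/val_inj/eqP; rewrite eqn_leq mroot// andbT.
    rewrite -[X in _ <= val X]rm root_map_anti//.
    by move: mW vW; rewrite !inE => /eqP -> /eqP ->.
  have vW : v \in W by rewrite -rhoW rv.
  rewrite vW -rv; have [_ -> _] := root_mapP f g v.
  by rewrite inE vW rv -leqNgt tm.
split=> //.
apply/setP => v; rewrite !inE; have [vW|vW] := boolP (v \in W); last first.
  rewrite inE in vW; rewrite (negbTE vW) /=; apply/negbTE; apply: contraNN vW.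
  by move=> /eqP rv; have := rhoW v; rewrite rv mW inE.
have := vW; rewrite inE => -> /=; rewrite -val_eqE /= ltnS.
have := mroot v vW; case: (ltnP (rho v) t) => [vt _|tv /(_ isT)] /=.
  by rewrite (leq_trans (ltnW vt) tm).
by rewrite eqn_leq => ->; rewrite andbT.
Qed.

Let components_unionP k :
  exists t, components_union W gW k = [set v in W | rho v < t].
Proof.
elim: k => [|k [t /= ->]].
  by exists 0; apply/setP => v; rewrite !inE andbF.
have [[m [_ _ _ _ ->]]|[_ ->]] := next_componentP t.
  by exists m.+1.
by exists t; rewrite setU0.
Qed.

Lemma prod_source_partition (R : comNzRingType) (p : nat -> R) :
  (\prod_(k <- source_partition W gW) p k =
   \prod_(x | (rho x == x) && (f x == 0%N)) p #|fibre rho x|)%R.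
Proof.
have prodE k : (\prod_(j <- iota 0 k | source_component W gW j != set0)
    p #|source_component W gW j| =
    \prod_(x | (rho x == x) && (x \in components_union W gW k))
      p #|fibre rho x|)%R.
  elim: k => [|k IHk].
    by rewrite big_nil big_pred0// => x; rewrite inE andbF.
  rewrite -addn1 iotaD big_cat big_cons big_nil add0n addn1 IHk /source_component /=.
  have [t tE] := components_unionP k; rewrite tE.
  have [[m [mW rm tm -> _]]|[_ ->]] := next_componentP t; last by rewrite eqxx /= mulr1 setU0.
  have -> : fibre rho m != set0 by apply/set0Pn; exists m; rewrite inE rm.
  rewrite mulr1 mulrC [RHS](bigD1 m)/=; last by rewrite !inE rm eqxx orbT.
  congr (_ * _)%R; apply: eq_bigl => x; rewrite !inE.
  case: (eqVneq (rho x) x) => //= ->; case: (eqVneq x m) => [->|]; last by rewrite orbF andbT.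
  by rewrite andbF ltnNge tm andbF.
rewrite /source_partition (perm_big _ (permEl (perm_sort _ _))) big_map big_filter.
rewrite prodE; apply: eq_bigl => x; congr (_ && _).
suff -> : components_union W gW #|W| = W by rewrite inE.
have sub k : components_union W gW k \subset W.
  by have [t ->] := components_unionP k; apply/subsetP => v; rewrite inE => /andP[].
(* Each step adds at least the vertex [m] until [W] is exhausted, so [#|W|] steps suffice. *)
have grow k : minn k #|W| <= #|components_union W gW k|.
  elim: k => [|k IHk]; first by rewrite min0n.
  rewrite /=; have [t tE] := components_unionP k.
  have := next_componentP t; rewrite -tE => -[[m [mW rm tm mE _]]|[WE ->]]; last first.
    by rewrite setU0 -WE geq_minr.
  have mU : m \notin components_union W gW k by rewrite tE inE rm mW /= -leqNgt.
  apply: (@leq_trans #|components_union W gW k|.+1); first (apply: leq_trans (_ : _ <= (minn k #|W|).+1) _ => //).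
    by rewrite -minnSS leq_min geq_minl leqW ?geq_minr.
  rewrite -add1n -[1%N](cards1 m) -cardsUI (_ : _ :&: _ = set0) ?cards0 ?addn0; last first.
    by apply/setP => v; rewrite !inE; case: eqP => // ->; rewrite (negbTE mU).
  apply: subset_leq_card; rewrite subUset subsetUl andbT sub1set inE mE.
  by rewrite [in X in _ || X]inE rm eqxx orbT.
by apply/eqP; rewrite eqEcard sub -{1}[#|W|]minnn grow.
Qed.

End SourceComponents.

From mathcomp Require Import finmap.
From mathcomp Require Import boolp classical_sets functions cardinality fsbigop.
From mathcomp.multinomials Require Import monalg.

Local Open Scope classical_set_scope.
Local Open Scope ring_scope.

(** * Truncated series *)

(** Distributivity: choosing a color for each fixed point of [r] is the same as choosing a coloring
    constant on the fibres. The color [c0] only fills in values at the other points during the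
    reindexing. *)
Lemma prod_sum_idempotent (R : comNzRingType) (T K : finType) (c0 : K)
    (r : {ffun T -> T}) (F : T -> K -> R) : (forall v, r (r v) = r v) ->
  \prod_(x | r x == x) \sum_c F x c =
  \sum_(f : {ffun T -> K} | [forall v, f (r v) == f v])
     \prod_(x | r x == x) F x (f x).
Proof.
move=> rr; rewrite (big_distr_big c0).
rewrite (reindex_onto (fun f : {ffun T -> K} => [ffun x => if r x == x then f x else c0])
  (fun f : {ffun T -> K} => [ffun x => f (r x)])) /=; last first.
  move=> f /pffun_onP[/supportP f0 _]; apply/ffunP => x; rewrite !ffunE.
  by case: eqP => [->//|rx]; rewrite f0//; apply/eqP.
apply: eq_big => [f|f _]; last by apply: eq_bigr => x rx; rewrite ffunE rx.
apply/andP/forallP => [[_ /eqP fE] v|fr].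
  by have /ffunP/(_ v) := fE; rewrite !ffunE rr eqxx => ->.
split; last first.
  by apply/eqP/ffunP => v; rewrite !ffunE rr eqxx; apply/eqP.
by apply/pffun_onP; split=> //; apply/supportP => x; rewrite ffunE => xr; rewrite ifN.
Qed.

Section Truncation.
Context (R : comNzRingType) (I : choiceType).
Implicit Types (F G : series R I) (m : {cmonom I}) (B : pred I).

Definition supported B m := all B (finsupp m).

Lemma supportedP B m : reflect (forall i, m i != 0%N -> B i) (supported B m).
Proof.
by apply: (iffP allP) => H i; have := H i; rewrite mem_finsupp.
Qed.

Lemma supportedM B m1 m2 :
  supported B (mmul m1 m2) = supported B m1 && supported B m2.
Proof.
apply/supportedP/andP => [H|[/supportedP H1 /supportedP H2] i].
  by split; apply/supportedP => i mi; apply: H; rewrite cmM addn_eq0 negb_and mi ?orbT.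
by rewrite cmM addn_eq0 negb_and => /orP[/H1|/H2].
Qed.

Lemma supported1 B : supported B mone.
Proof. by apply/supportedP => i; rewrite cm1. Qed.

(** The substitution of 0 for the variables outside [B]. It is multiplicative because a product of
    monomials is supported in [B] exactly when both factors are. *)
Definition strunc B F : series R I :=
  Series (fun m => if supported B m then F m else 0).

Fact strunc_zmod B : zmod_morphism (strunc B).
Proof.
move=> F G; apply: seriesP => m.
by rewrite scoefD scoefN /=; case: ifP; rewrite ?subr0.
Qed.

Fact strunc_monoid B : monoid_morphism (strunc B).
Proof.
split=> [|F G]; apply: seriesP => m.
  by rewrite scoef1 /=; case: eqP => [->|]; rewrite ?supported1//; case: ifP.
rewrite [RHS]scoefM -[LHS]/(if supported B m then (F * G) m else 0); case: ifP => mB; last first.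
  rewrite fsbig1// => -[a b] /= abm; move: mB; rewrite -abm supportedM.
  by case: (supported B a); case: (supported B b) => //= _; rewrite ?mulr0 ?mul0r.
rewrite scoefM; apply: eq_fsbigr => -[a b].
rewrite inE /= => abm; move: mB.
by rewrite -abm supportedM => /andP[-> ->].
Qed.

HB.instance Definition _ B :=
  GRing.isZmodMorphism.Build (series R I) (series R I) (strunc B) (strunc_zmod B).
HB.instance Definition _ B :=
  GRing.isMonoidMorphism.Build (series R I) (series R I) (strunc B) (strunc_monoid B).

Lemma struncM B F G : strunc B (F * G) = strunc B F * strunc B G.
Proof. exact: rmorphM. Qed.

Lemma struncX B F k : strunc B (F ^+ k) = strunc B F ^+ k.
Proof. exact: rmorphXn. Qed.

Lemma strunc_prod B (T : finType) (P : pred T) (F : T -> series R I) :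
  strunc B (\prod_(t | P t) F t) = \prod_(t | P t) strunc B (F t).
Proof. exact: rmorph_prod. Qed.

Lemma strunc_sum B (T : finType) (P : pred T) (F : T -> series R I) :
  strunc B (\sum_(t | P t) F t) = \sum_(t | P t) strunc B (F t).
Proof. exact: rmorph_sum. Qed.

Lemma strunc_scale B (a : R) F : strunc B (a *: F) = a *: strunc B F.
Proof.
by apply: seriesP => m; rewrite scoefZ /=; case: ifP; rewrite ?mulr0.
Qed.

Lemma supportedU B i : supported B (ucm i) = B i.
Proof.
apply/supportedP/idP => [->//|Bi j]; first by rewrite cmU eqxx.
by rewrite cmU; case: (i =P j) => [<-|].
Qed.

Lemma strunc_var B i : strunc B (svar i) = if B i then svar i else 0.
Proof.
apply: seriesP => m; rewrite /svar /=; case: (eqVneq m (ucm i)) => [->|mi].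
  by rewrite supportedU; case: ifP => //= _; rewrite eqxx.
by rewrite if_same; case: ifP => //= _; rewrite (negbTE mi).
Qed.

Lemma strunc_ssum B (T : choiceType) (A : set T) (F : T -> series R I) :
  strunc B (ssum A F) = ssum A (fun t => strunc B (F t)).
Proof.
apply: seriesP => m /=; case: ifP => // _; rewrite fsbig1//.
Qed.

Lemma scoef_sum (T : Type) (s : seq T) (P : pred T) (F : T -> series R I) m :
  (\sum_(t <- s | P t) F t) m = \sum_(t <- s | P t) F t m.
Proof. exact: (big_morph (fun F : series R I => F m)). Qed.

Lemma ssum_image (T : choiceType) (T' : finType) (h : T' -> T) (A : set T)
    (F : T -> series R I) : injective h ->
  (forall t, A t -> F t != 0 -> exists t', t = h t') ->
  ssum A F = \sum_(t' | h t' \in A) F (h t').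
Proof.
move=> h_inj hA; apply: seriesP => m; rewrite scoef_sum /=.
have -> : A = [set` mem A] by rewrite set_mem_set.
rewrite -(bigfs _ (r := [seq h t' | t' <- enum T'])).
- rewrite big_map big_enum_cond /=; apply: eq_bigl => t'.
  by rewrite set_mem_set.
- by rewrite map_inj_uniq// enum_uniq.
move=> t /set_mem At tN; have [F0|/(hA _ At)[t' tE]] := eqVneq (F t) 0.
  by rewrite F0.
by case/negP: tN; rewrite tE map_f// mem_enum.
Qed.

(** A monomial involves finitely many variables, so each coefficient is already visible in some
    truncation. *)
Lemma eq_strunc (B : nat -> pred I) F G : (forall m, exists k, supported (B k) m) ->
  (forall k, strunc (B k) F = strunc (B k) G) -> F = G.
Proof.
move=> Bm FG; apply: seriesP => m; have [k km] := Bm m.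
by have /(congr1 (fun H : series R I => H m)) /= := FG k; rewrite km.
Qed.

Lemma strunc_psum B (J : choiceType) (K : finType) (h : K -> J) (c : J -> I) k :
  injective h -> (forall j, B (c j) <-> exists t, j = h t) -> (0 < k)%N ->
  strunc B (psum c k) = \sum_t svar (c (h t)) ^+ k.
Proof.
move=> h_inj hB k0; rewrite strunc_ssum (ssum_image h_inj) => [|j _].
  rewrite (eq_bigl predT) => [|t]; last exact: mem_set.
  apply: eq_bigr => t _; rewrite rmorphXn /= strunc_var.
  by rewrite (_ : B _) //; apply/hB; exists t.
rewrite rmorphXn /= strunc_var; case: ifP => [/hB//|_].
(* A killed variable contributes [0 ^+ k], which vanishes only for positive [k]. *)
by rewrite expr0n; case: k k0 => //= k _; rewrite eqxx.
Qed.

End Truncation.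

(** * Newton's identities *)

Section Newton.
Context (R : comNzRingType) (I : choiceType).
Implicit Types (F G : series R I) (m : {cmonom I}).

Lemma scoef_ssum_smonom (A : set {cmonom I}) m :
  ssum A (@smonom R I) m = (m \in A)%:R.
Proof.
rewrite /=; have {1}-> : A = [set` mem A] by rewrite set_mem_set.
rewrite -(bigfs _ (r := [:: m])) //.
  by rewrite big_cons big_nil /= eqxx addr0 -[X in if X then _ else _]/(m \in A); case: (m \in A).
by move=> m' _ /=; rewrite inE eq_sym => /negbTE ->.
Qed.

Definition xcm i k : {cmonom I} := \big[mmul/mone]_(j < k) ucm i.

Lemma xcmE i k j : xcm i k j = (k * (i == j))%N.
Proof.
elim: k => [|k IHk]; rewrite /xcm; first by rewrite big_ord0 cm1.
by rewrite big_ord_recl cmM cmU -/(xcm i k) IHk mulSn.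
Qed.

Lemma mdeg_xcm i k : mdeg (xcm i k) = k.
Proof. by rewrite mdeg_prod (eq_bigr (fun=> 1%N)) ?sum1_card ?card_ord// => j _; rewrite mdegU. Qed.

Lemma scoef_varXM i k F m :
  (svar i ^+ k * F) m = if (k <= m i)%N then F (divcm m (xcm i k)) else 0.
Proof.
have -> : svar i ^+ k = smonom R (xcm i k).
  by rewrite smonom_prod prodr_const cardT size_enum_ord.
rewrite -[LHS]/(smul _ _ m) smonom_mul; case: ifP => kmi; last first.
  rewrite big1// => b /eqP bm; move: kmi; rewrite -bm cmM xcmE eqxx muln1.
  by rewrite leq_addr.
have dE : mmul (xcm i k) (divcm m (xcm i k)) = m.
  apply/eqP/cmP => j; rewrite cmM divcmE subnKC// xcmE.
  by case: eqP => [<-|]; rewrite ?muln1 ?muln0.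
rewrite (bigID (pred1 (divcm m (xcm i k)))) /= [X in _ + X]big1 ?addr0.
  rewrite (eq_bigl (pred1 (divcm m (xcm i k)))) => [|b /=]; last first.
    by case: (b =P divcm m (xcm i k)) => [->|]; rewrite ?andbT ?andbF// dE eqxx.
  rewrite -big_filter filter_pred1_uniq ?undup_uniq ?big_seq1//.
  by apply: (@mem_divisors_seq _ _ _ (xcm i k)); rewrite mulmC.
move=> b /andP[/eqP bm /eqP[]]; apply/eqP/cmP => j.
by rewrite divcmE -bm cmM addKn.
Qed.

(** Truncating to the variables of [m] keeps the coefficient at [m] and makes the power sum
    finite. *)
Lemma scoef_psumM k F m : (0 < k)%N ->
  (psum id k * F) m = \sum_(i : finsupp m) (svar (val i) ^+ k * F) m.
Proof.
move=> k0; pose B := mem (finsupp m).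
have mB : supported B m by apply/allP.
have BE G : G m = strunc B G m by rewrite /= mB.
rewrite BE struncM (strunc_psum _ (K := finsupp m) val_inj)//; last first.
  by move=> i; split=> [im|[t ->]]; [exists [` im]%fset|exact: valP].
rewrite mulr_suml scoef_sum; apply: eq_bigr => i _; rewrite [RHS]BE struncM struncX.
by rewrite strunc_var [B _](valP i).
Qed.

Lemma mdeg_divcm i k m : (k <= m i)%N -> mdeg (divcm m (xcm i k)) = (mdeg m - k)%N.
Proof.
move=> kmi; have {2}<- : mmul (divcm m (xcm i k)) (xcm i k) = m.
  apply/eqP/cmP => j; rewrite cmM divcmE subnK// xcmE.
  by case: eqP => [<-|]; rewrite ?muln1 ?muln0.
by rewrite mdegM mdeg_xcm addnK.
Qed.

Lemma leq_mdeg i m : (m i <= mdeg m)%N.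
Proof.
rewrite mdegE; have [im|/fsfun_dflt ->//] := boolP (i \in finsupp m).
by rewrite (big_fsetD1 i)//= leq_addr.
Qed.

Lemma complete_coef k m : (complete k : symfun R I) m = (mdeg m == k)%:R.
Proof.
rewrite scoef_ssum_smonom; congr (nat_of_bool _)%:R.
by apply/idP/eqP => [/set_mem|/mem_set].
Qed.

Lemma elementary_coef k m : (elementary k : symfun R I) m =
  ((mdeg m == k) && [forall i : finsupp m, m (val i) <= 1]%N)%:R.
Proof.
rewrite scoef_ssum_smonom; congr (nat_of_bool _)%:R.
apply/idP/andP => [/set_mem[mk m1]|[/eqP mk /forallP m1]].
  by split; [exact/eqP|apply/forallP].
apply/mem_set; split=> // i; have [im|/fsfun_dflt ->//] := boolP (i \in finsupp m).
by have := m1 [` im]%fset.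
Qed.

Lemma symfun_valM (F G : symfun R I) :
  symfun_val (F * G) = symfun_val F * symfun_val G.
Proof. by []. Qed.

Lemma symfun_val_sum (T : Type) (s : seq T) (P : pred T) (F : T -> symfun R I) :
  symfun_val (\sum_(t <- s | P t) F t) = \sum_(t <- s | P t) symfun_val (F t).
Proof. by rewrite -[LHS]/(val (\sum_(t <- s | P t) F t)) rmorph_sum. Qed.

Lemma symfun_val_prod (T : Type) (s : seq T) (P : pred T) (F : T -> symfun R I) :
  symfun_val (\prod_(t <- s | P t) F t) = \prod_(t <- s | P t) symfun_val (F t).
Proof. by rewrite -[LHS]/(val (\prod_(t <- s | P t) F t)) rmorph_prod. Qed.

Lemma symfun_valZ (a : R) (F : symfun R I) :
  symfun_val (a *: F) = a *: symfun_val F.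
Proof. by []. Qed.

Lemma symfunP (F G : symfun R I) :
  (forall m, symfun_val F m = symfun_val G m) -> F = G.
Proof. by move=> FG; apply/val_inj/seriesP. Qed.

Lemma sum_leq a K : (a <= K)%N -> \sum_(1 <= k < K.+1) (k <= a)%N%:R = a%:R :> R.
Proof.
move=> aK; rewrite (big_cat_nat (n := a.+1)) //= [X in _ + X]big_nat [X in _ + X]big1 ?addr0.
  rewrite big_nat (eq_bigr (fun=> 1)) => [|k /andP[_]]; last by rewrite ltnS => ->.
  by rewrite -big_nat sumr_const_nat subSS subn0.
by move=> k /andP[ki _]; rewrite leqNgt ki.
Qed.

(** At a monomial [m] of degree [K], the variable [i] contributes one for each [k] from 1 to [m i],
    and the exponents add up to [K]. *)
Lemma newton_complete K : K%:R *: complete K =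
  \sum_(1 <= k < K.+1) power_sum k * complete (K - k) :> symfun R I.
Proof.
apply: symfunP => m; rewrite symfun_val_sum symfun_valZ scoefZ scoef_sum.
under eq_big_nat => k /andP[k0 _] do rewrite symfun_valM scoef_psumM//.
rewrite exchange_big complete_coef.
transitivity (\sum_(i : finsupp m) (mdeg m == K)%:R * (m (val i))%:R : R).
  rewrite -mulr_sumr -natr_sum mdegE -(big_seq_fsetE _ _ xpredT) /= -mdegE mulrC.
  by case: eqP => [->|_]; rewrite ?mulr0 ?mul0r// mulr1 mul1r.
apply: eq_bigr => i _; under eq_bigr do rewrite scoef_varXM.
have mi := leq_mdeg (val i) m; have [mK|mK] := eqVneq (mdeg m) K; last first.
  rewrite mul0r big_nat big1// => k /andP[k1 kK]; case: ifP => // ki.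
  rewrite complete_coef mdeg_divcm// eqn_sub2rE//.
    by rewrite (negbTE mK).
  by apply: leq_trans mi.
rewrite mul1r; rewrite mK in mi.
rewrite -(sum_leq mi) [LHS]big_nat [RHS]big_nat; apply: eq_bigr => k _.
by case: ifP => ki; rewrite // complete_coef mdeg_divcm// mK eqxx.
Qed.

(** For [a] at least 2 the terms [k = a - 1] and [k = a] cancel. For [a = 1] the first of them is
    out of range and [k = 1] survives. *)
Lemma alternating_pair a K : (a <= K)%N ->
  \sum_(1 <= k < K.+1) (-1) ^+ k.-1 * (k <= a <= k.+1)%N%:R = (a == 1)%:R :> R.
Proof.
case: a => [|[|a]] aK.
- by rewrite big_nat big1// => k /andP[k0 _]; rewrite leqn0 gtn_eqF// mulr0.
- rewrite big_nat_recl//= mulr1 big_nat big1 ?addr0// => k /andP[k0 _].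
  by rewrite ltnS leqn0 gtn_eqF// mulr0.
rewrite (big_cat_nat (n := a.+1))//=; last by apply: leqW; apply: ltnW.
rewrite big_nat big1 ?add0r => [|k /andP[_ ka]]; last first.
  by rewrite [(a.+2 <= k.+1)%N]leqNgt ltnS ka andbF mulr0.
rewrite big_ltn; last by apply: leqW.
rewrite big_ltn//= big_nat big1 ?addr0 => [|k /andP[ka _]]; last first.
  by rewrite leqNgt ka mulr0.
by rewrite leqnSn !leqnn leqnSn !mulr1 exprS mulN1r subrr.
Qed.

(** Dividing [m] by the [k]-th power of the variable [i] leaves a squarefree monomial when
    [k <= m i <= k.+1] and the other exponents are at most 1, which is [Q i]. The alternating sum
    over [k] keeps only [m i = 1], so a monomial with a repeated variable gets 0 and a squarefree
    one gets its degree. *)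
Lemma newton_elementary K : K%:R *: elementary K =
  \sum_(1 <= k < K.+1) (-1) ^+ k.-1 *: (power_sum k * elementary (K - k))
  :> symfun R I.
Proof.
apply: symfunP => m; rewrite symfun_val_sum symfun_valZ scoefZ scoef_sum.
under eq_big_nat => k /andP[k0 _] do
  rewrite symfun_valZ symfun_valM scoefZ scoef_psumM// mulr_sumr.
rewrite exchange_big elementary_coef.
pose Q (i : I) := [forall j : finsupp m, (val j != i) ==> (m (val j) <= 1)%N].
transitivity (\sum_(i : finsupp m) ((mdeg m == K) && Q (val i))%:R *
   (m (val i) == 1)%:R : R).
  case: eqP => [mK|_] /=; last by rewrite mulr0 big1// => i _; rewrite mul0r.
  have [/forallP m1|] := boolP [forall i : finsupp m, (m (val i) <= 1)%N].
    rewrite mulr1 -mK mdegE (big_seq_fsetE _ _ xpredT) /= natr_sum.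
    apply: eq_bigr => i _; have -> : Q (val i).
      by apply/forallP => j; apply/implyP => _; exact: m1.
    rewrite mul1r; have := m1 i; have := valP i; rewrite mem_finsupp.
    by case: (m (val i)) => [|[|]].
  rewrite mulr0 negb_forall => /existsP[j mj]; rewrite big1// => i _.
  have [ij|ij] := eqVneq (val j) (val i).
    by rewrite -ij (_ : (m (val j) == 1)%N = false) ?mulr0//; case: (m (val j)) mj => [|[|]].
  rewrite (_ : Q (val i) = false) ?mul0r//; apply/negbTE; rewrite negb_forall.
  by apply/existsP; exists j; rewrite ij.
apply: eq_bigr => i _.
have mi := leq_mdeg (val i) m.
transitivity (\sum_(1 <= k < K.+1) ((mdeg m == K) && Q (val i))%:R *
   ((-1) ^+ k.-1 * (k <= m (val i) <= k.+1)%N%:R) : R).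
  rewrite -mulr_sumr; case: eqP => [mK|_]; last by rewrite !mul0r.
  by rewrite alternating_pair// -mK.
rewrite [LHS]big_nat [RHS]big_nat; apply: eq_bigr => k /andP[k1 kK].
rewrite mulrCA; congr (_ * _); rewrite scoef_varXM; case: ifP => ki; last by rewrite mulr0.
rewrite elementary_coef mdeg_divcm// eqn_sub2rE//; last by apply: leq_trans mi.
case: eqP => _; last by rewrite mul0r.
rewrite -natrM mulnb; congr (nat_of_bool _)%:R; set d := divcm m _.
have dE j : d j = (m j - k * (val i == j))%N by rewrite divcmE xcmE.
have all_le1 m' (P : pred I) : [forall j : finsupp m', P (val j) ==> (m' (val j) <= 1)%N] ->
    forall j, P j -> (m' j <= 1)%N.
  move=> /forallP H j Pj; have [jm|/fsfun_dflt ->//] := boolP (j \in finsupp m').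
  exact: (implyP (H [` jm]%fset)).
apply/andP/forallP => [[Qi mik] j|d1].
  rewrite dE; have [<-|ij] := eqVneq (val i) (val j).
    by rewrite muln1 leq_subLR addn1.
  rewrite muln0 subn0; apply: (all_le1 m (predC1 (val i))) => //=.
  by rewrite eq_sym.
have {}d1 j : (d j <= 1)%N by apply: (all_le1 d predT) => //; apply/forallP => l; rewrite d1.
split.
  apply/forallP => j; apply/implyP => ji; have := d1 (val j).
  by rewrite dE eq_sym (negbTE ji) muln0 subn0.
by have := d1 (val i); rewrite dE eqxx muln1 leq_subLR addn1.
Qed.

Lemma symfun_val1 : symfun_val (1 : symfun R I) = 1.
Proof. by []. Qed.

Lemma complete0 : complete 0 = 1 :> symfun R I.
Proof.
by apply: symfunP => m; rewrite complete_coef symfun_val1 scoef1 mdeg_eq0.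
Qed.

End Newton.

(** Apply [omega] to the identity for [elementary k] and compare it with the one for [complete k].
    By induction the terms below [k] agree, and the last terms give the claim. *)
Lemma omega_power_sum (I : choiceType) (omega : {lrmorphism symfun rat I -> symfun rat I}) k :
  (forall k : nat, omega (elementary k) = complete k) -> (0 < k)%N ->
  omega (power_sum k) = (-1) ^+ k.-1 *: power_sum k.
Proof.
move=> omega_eh; elim/ltn_ind: k => k IHk k0.
have omegaZ a F : omega (a *: F) = a *: omega F by exact: linearZZ.
have omegaM F G : omega (F * G) = omega F * omega G by exact: rmorphM.
have omega_sum (F : nat -> symfun rat I) :
    omega (\sum_(1 <= i < k.+1) F i) = \sum_(1 <= i < k.+1) omega (F i).
  exact: raddf_sum.
have : \sum_(1 <= i < k.+1) power_sum i * complete (k - i) =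
    \sum_(1 <= i < k.+1) (-1) ^+ i.-1 *: (omega (power_sum i) * complete (k - i)).
  rewrite -newton_complete -omega_eh -omegaZ newton_elementary omega_sum.
  by apply: eq_bigr => i _; rewrite omegaZ omegaM omega_eh.
rewrite !big_nat_recr// subnn complete0 !mulr1 [X in _ = X + _ -> _](_ : _ =
    \sum_(1 <= i < k) power_sum i * complete (k - i)); last first.
  apply: eq_big_nat => i /andP[i0 ik].
  by rewrite IHk// -scalerAl scalerA -expr2 sqrr_sign scale1r.
by move=> /addrI pE; rewrite [in RHS]pE scalerA -expr2 sqrr_sign scale1r.
Qed.

(** * The expansion *)

Lemma prod_eq0 (R : comNzRingType) (T : finType) (P : pred T) (F : T -> R) x :
  P x -> F x = 0 -> \prod_(t | P t) F t = 0.
Proof. by move=> Px Fx; rewrite (bigD1 x)//= Fx mul0r. Qed.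

Lemma prod_fibres (R : comNzRingType) n (r : {ffun 'I_n -> 'I_n}) (P : pred 'I_n)
    (G : 'I_n -> R) : (forall v, r (r v) = r v) ->
  \prod_(v | P (r v)) G (r v) = \prod_(x | (r x == x) && P x) G x ^+ #|fibre r x|.
Proof.
move=> rr; rewrite (partition_big r (fun x => (r x == x) && P x)) /=; last first.
  by move=> v ->; rewrite rr eqxx.
apply: eq_bigr => x /andP[_ Px]; rewrite -prodr_const; apply: eq_big => [v|v /andP[_ /eqP ->]//].
by rewrite inE; case: (eqVneq (r v) x) => [->|]; rewrite ?Px ?andbT ?andbF.
Qed.

(** The fibre of [r v] contains [v]; being non-empty with a rooted orientation, it contains its own
    label. *)
Lemma rooted_idempotent n (e : rel 'I_n) (r : {ffun 'I_n -> 'I_n}) :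
  (\prod_x #|rooted_orientations e x (fibre r x)|)%N != 0%N ->
  forall v, r (r v) = r v.
Proof.
move=> a0 v; apply/eqP; apply: contraNT a0 => rv; rewrite (bigD1 (r v))//=.
by rewrite (@card_rooted_eq0 _ _ _ _ v) ?inE// (negbTE rv).
Qed.

Lemma prod_signed_rooted n (e : rel 'I_n) (r : {ffun 'I_n -> 'I_n}) :
  \prod_x signed_rooted rat e x (fibre r x) =
  (\prod_x (-1) ^+ #|fibre r x|.-1) *
  (\prod_x #|rooted_orientations e x (fibre r x)|)%N%:R.
Proof. by rewrite big_split /= natr_prod. Qed.

Lemma card_fibre_gt0 n (r : {ffun 'I_n -> 'I_n}) x : r x = x -> (0 < #|fibre r x|)%N.
Proof. by move=> rx; rewrite card_gt0; apply/set0Pn; exists x; rewrite inE rx. Qed.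

Section ChromaticPowerSum.
Context (n : nat) (e : rel 'I_n).
Hypothesis e_sym : symmetric e.

Lemma proper_coloringE (I : choiceType) (f : {ffun 'I_n -> I}) :
  (f \in [set f | proper_coloring e f]) =
  [forall u, forall v, e u v ==> (f u != f v)].
Proof.
apply/idP/'forall_'forall_implyP => [/set_mem H u v /H//|H].
by apply/mem_set => u v /H.
Qed.

(** With finitely many colors, expand the properness of each coloring by [proper_partitions] and
    exchange the sums. For a fixed [r] the colorings constant on its blocks sum to a product of
    power sums, one for each block. *)
Lemma chromatic_power_sum : chromatic e =
  \sum_(r : {ffun 'I_n -> 'I_n}) (\prod_x signed_rooted rat e x (fibre r x)) *:
     \prod_(x | r x == x) power_sum #|fibre r x| :> symfun rat nat.
Proof.
apply: symfunP; pose B N : pred nat := fun i => (i < N.+1)%N.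
suff: symfun_val (chromatic e) = \sum_(r : {ffun 'I_n -> 'I_n})
    (\prod_x signed_rooted rat e x (fibre r x)) *:
     \prod_(x | r x == x) psum id #|fibre r x| :> series rat nat.
  move=> -> m; rewrite symfun_val_sum; congr (scoef _ m); apply: eq_bigr => r _.
  by rewrite symfun_valZ symfun_val_prod.
apply: (@eq_strunc _ _ B) => [m|N].
  exists (\max_(i <- finsupp m) i)%N; apply/allP => i im.
  rewrite /B ltnS. exact: (@leq_bigmax_seq _ (enum_fset (finsupp m)) xpredT (fun i => i) i im isT).
pose h (f : {ffun 'I_n -> 'I_N.+1}) : {ffun 'I_n -> nat} := [ffun v => val (f v)].
have h_inj : injective h.
  by move=> f f' /ffunP ff'; apply/ffunP => v; apply/val_inj; have := ff' v; rewrite !ffunE.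
have struncP (f : {ffun 'I_n -> nat}) :
    strunc (B N) (\prod_v svar (f v)) = \prod_v (if B N (f v) then svar (f v) else 0) :> series rat nat.
  by rewrite rmorph_prod; apply: eq_bigr => v _; rewrite -strunc_var.
rewrite [LHS]strunc_ssum (ssum_image h_inj); last first.
  move=> f _; rewrite struncP => f0; exists [ffun v => inord (f v)].
  apply/ffunP => v; rewrite !ffunE /= inordK//; apply: contraNT f0 => fv.
  apply/eqP; apply: (prod_eq0 (x := v)) => //.
  by rewrite /B (negbTE fv).
transitivity (\sum_(f : {ffun 'I_n -> 'I_N.+1})
    [forall u, forall v, e u v ==> (f u != f v)]%:R *: \prod_v svar (val (f v)) : series rat nat).
  rewrite big_mkcond; apply: eq_bigr => f _; rewrite proper_coloringE.
  rewrite (_ : [forall u, _] = [forall u, forall v, e u v ==> (f u != f v)]); last first.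
    by apply: eq_forallb => u; apply: eq_forallb => v; rewrite !ffunE.
  case: ifP => _; last by rewrite scale0r.
  by rewrite scale1r struncP; apply: eq_bigr => v _; rewrite ffunE /B ltn_ord.
under eq_bigr do rewrite (proper_partitions rat _ e_sym) scaler_suml.
rewrite (exchange_big_dep xpredT)//= rmorph_sum; apply: eq_bigr => r _.
rewrite -scaler_sumr [RHS]strunc_scale.
have [a0|/rooted_idempotent rr] :=
    eqVneq (\prod_x #|rooted_orientations e x (fibre r x)|)%N 0%N.
  by rewrite [X in X *: _ = _]prod_signed_rooted prod_signed_rooted a0 mulr0 !scale0r.
congr (_ *: _); rewrite rmorph_prod.
transitivity (\prod_(x | r x == x) \sum_(c < N.+1) svar (val c) ^+ #|fibre r x| : series rat nat).
  rewrite (prod_sum_idempotent ord0 _ rr); apply: eq_bigr => f /forallP fr.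
  transitivity (\prod_v svar (val (f (r v))) : series rat nat).
    by apply: eq_bigr => v _; rewrite (eqP (fr v)).
  rewrite (prod_fibres xpredT (fun x => svar (val (f x))) rr).
  by apply: eq_bigl => x; rewrite andbT.
apply: eq_bigr => x /eqP rx.
rewrite -[RHS]/(strunc (B N) (psum id _)) (@strunc_psum _ _ _ _ _ (@nat_of_ord N.+1))//.
- exact: ord_inj.
- by move=> j; split=> [jN|[t ->]]; [exists (Ordinal jN)|exact: ltn_ord].
- exact: card_fibre_gt0.
Qed.

End ChromaticPowerSum.

Section RootTerms.
Context (n : nat).
Implicit Types (g : {set 'I_n * 'I_n}).

Definition root_weight (c k : nat) : yz_series :=
  if c == 0%N then p_y k else zvar c ^+ k.

Lemma prod_color_classes (R : comNzRingType) (f : {ffun 'I_n -> nat}) (G : nat -> R) :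
  \prod_(1 <= i < (\max_(v : 'I_n) f v).+1) G i ^+ #|[set v | f v == i]%SET| =
  \prod_(v | f v != 0%N) G (f v).
Proof.
transitivity (\prod_(1 <= i < (\max_(v : 'I_n) f v).+1) \prod_(v | f v == i) G (f v)).
  apply: eq_bigr => i _; rewrite -prodr_const; apply: eq_big => [v|v]; rewrite inE//.
  by move=> /eqP ->.
rewrite (exchange_big_dep xpredT)//= [RHS]big_mkcond; apply: eq_bigr => v _.
have fv : (f v <= \max_(v : 'I_n) f v)%N by apply: leq_bigmax.
rewrite -big_filter; case: ifPn => [fv0|fv0].
  rewrite (eq_filter (a2 := pred1 (f v))) => [|i]; last by rewrite /= eq_sym.
  rewrite filter_pred1_uniq ?iota_uniq ?big_seq1//.
  by rewrite mem_index_iota lt0n fv0 ltnS.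
rewrite big_filter big_seq_cond big_pred0// => i; rewrite mem_index_iota.
by move: fv0; rewrite negbK => /eqP ->; case: i => // i; rewrite andbF.
Qed.

(** Rewrites a term of the theorem as a product over blocks. Blocks of color 0 are the
    source-components; on the others each vertex has the color of its root, so the powers of [zvar]
    collect block by block. *)
Lemma root_terms g (f : {ffun 'I_n -> nat}) : no_descent g f ->
  let W := [set v | f v == 0%N]%SET in
  p_part_y (source_partition W (restrict_arcs W g)) *
    \prod_(1 <= i < (\max_(v : 'I_n) f v).+1) zvar i ^+ #|[set v | f v == i]%SET| =
  \prod_(x | root_map f g x == x)
     root_weight (f x) #|fibre (root_map f g) x|.
Proof.
move=> fg W; rewrite /p_part_y prod_source_partition// prod_color_classes.
rewrite [RHS](bigID (fun x => f x == 0%N)); congr (_ * _).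
  by apply: eq_bigr => x /andP[_ fx]; rewrite /root_weight fx.
transitivity (\prod_(v | f (root_map f g v) != 0%N) zvar (f (root_map f g v))).
  by apply: eq_big => [v|v _]; have [-> _ _] := root_mapP f g v.
rewrite (prod_fibres (fun x => f x != 0%N) (fun x => zvar (f x)) (root_mapK f g)).
by apply: eq_bigr => x /andP[_ fx]; rewrite /root_weight (negbTE fx).
Qed.

End RootTerms.

(* omega is the endomorphism of the algebra of symmetric functions such that
   omega (e_k) = h_k, and add_yz the substitution F(z) |-> F(y + z); both are
   determined by the conditions imposed on them. *)
Theorem theorem5p6 (n : nat) (e : rel 'I_n)
    (e_sym : symmetric e) (e_irr : irreflexive e)
    (omega : {lrmorphism symfun rat nat -> symfun rat nat})
    (omega_eh : forall k : nat, omega (elementary k) = complete k)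
    (add_yz : {lrmorphism symfun rat nat -> yz_series})
    (add_yz_p : forall k : nat, (0 < k)%N ->
       add_yz (power_sum k) = p_y k + p_z k) :
  add_yz (omega (chromatic e)) =
  ssum [set gf : {set 'I_n * 'I_n} * {ffun 'I_n -> nat} |
          [/\ orientation e gf.1, acyclic gf.1 & no_descent gf.1 gf.2]]
    (fun gf =>
       let: (g, f) := gf in
       let W := [set v | f v == 0%N]%SET in
       p_part_y (source_partition W (restrict_arcs W g)) *
       \prod_(1 <= i < (\max_(v : 'I_n) f v).+1)
          zvar i ^+ #|[set v | f v == i]%SET|).
Proof.
pose a (r : {ffun 'I_n -> 'I_n}) := (\prod_x #|rooted_orientations e x (fibre r x)|)%N.
(* The sign of each block appears twice, once from [signed_rooted] and once from [omega], and
   cancels. A label that is not a fixed point of [r] has an empty fibre, hence sign 1. *)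
have -> : add_yz (omega (chromatic e)) = \sum_(r : {ffun 'I_n -> 'I_n})
    (a r)%:R * \prod_(x | r x == x) (p_y #|fibre r x| + p_z #|fibre r x|).
  have omegaZ c F : omega (c *: F) = c *: omega F by exact: linearZZ.
  have add_yzZ c F : add_yz (c *: F) = c *: add_yz F by exact: linearZZ.
  have comp_sum (F : {ffun 'I_n -> 'I_n} -> symfun rat nat) :
      add_yz (omega (\sum_r F r)) = \sum_r add_yz (omega (F r)).
    by rewrite !raddf_sum.
  have comp_prod (P : pred 'I_n) (F : 'I_n -> symfun rat nat) :
      add_yz (omega (\prod_(x | P x) F x)) = \prod_(x | P x) add_yz (omega (F x)).
    by rewrite !rmorph_prod.
  rewrite chromatic_power_sum// comp_sum; apply: eq_bigr => r _.
  rewrite omegaZ add_yzZ comp_prod prod_signed_rooted -/(a r).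
  have [->|/rooted_idempotent rr] := eqVneq (a r) 0%N.
    by rewrite mulr0 scale0r mul0r.
  have pE x : r x == x -> add_yz (omega (power_sum #|fibre r x|)) =
      (-1) ^+ #|fibre r x|.-1 *: (p_y #|fibre r x| + p_z #|fibre r x|).
    move=> /eqP/card_fibre_gt0 x0.
    by rewrite (omega_power_sum omega_eh x0) add_yzZ add_yz_p.
  rewrite [X in _ *: X](eq_bigr _ pE).
  rewrite scaler_prod scalerA mulrAC [X in _ * X * _]big_mkcond -big_split /=.
  rewrite [X in X * _]big1 ?mul1r ?scaler_nat ?mulr_natl// => x _.
  have [_|rx] := eqVneq (r x) x; first by rewrite -expr2 sqrr_sign.
  rewrite (_ : fibre r x = finset.set0) ?cards0 ?mulr1//.
  apply/setP => v; rewrite !inE; apply: contraNF rx => /eqP <-.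
  by rewrite rr.
(* Keeps the first [N] of the y variables and the first [N] of the z variables; the colors are then
   0 to [N], color 0 standing for all of y. *)
pose B N : pred (nat + nat) := fun i => match i with inl i => (i < N)%N | inr i => (i < N)%N end.
apply: (@eq_strunc _ _ B) => [m|N].
  exists (\max_(i <- finsupp m) match i with inl i => i | inr i => i end).+1.
  apply/allP => i im; rewrite /B.
  have := @leq_bigmax_seq _ (enum_fset (finsupp m)) xpredT
    (fun i => match i with inl i => i | inr i => i end) i im isT.
  by case: i im => i _; rewrite ltnS.
pose wt (c : 'I_N.+1) k : yz_series := strunc (B N) (root_weight c k).
(* Color 0 gives the y part. A color [c.+1] is the variable [inr c], so the remaining [N] colors
   give the truncated z part. *)
have wtE k : (0 < k)%N -> \sum_c wt c k = strunc (B N) (p_y k + p_z k).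
  move=> k0; rewrite rmorphD big_ord_recl /wt /root_weight /=; congr (_ + _).
  rewrite (@strunc_psum _ _ _ _ _ (@nat_of_ord N))//.
  - by apply: eq_bigr => c _; rewrite /zvar /bump leq0n add1n /= struncX strunc_var /B ltn_ord.
  - exact: ord_inj.
  - by move=> j; split=> [jN|[t ->]]; [exists (Ordinal jN)|exact: ltn_ord].
pose h (f : {ffun 'I_n -> 'I_N.+1}) : {ffun 'I_n -> nat} := [ffun v => val (f v)].
pose h2 (gf : {set 'I_n * 'I_n} * {ffun 'I_n -> 'I_N.+1}) := (gf.1, h gf.2).
have h2_inj : injective h2.
  move=> [g f] [g' f'] [-> /ffunP ff']; congr (_, _); apply/ffunP => v.
  by apply/val_inj; have := ff' v; rewrite !ffunE.
rewrite [RHS]strunc_ssum (ssum_image h2_inj); last first.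
  (* If some [v] has a color above [N], its root has that color too, and the factor of this
     non-empty block is a positive power of a killed variable. *)
  move=> [g f] [/= og ag fg]; rewrite root_terms// strunc_prod => gf0.
  exists (g, [ffun v => inord (f v)]); congr (_, _).
  apply/ffunP => v; rewrite !ffunE /= inordK//; apply: contraNT gf0 => fv.
  have [fr _ _] := root_mapP f g v.
  apply/eqP; apply: (prod_eq0 (x := root_map f g v)); first by rewrite root_mapK.
  rewrite fr /root_weight; move: fv; case: (f v) => // c cN.
  rewrite struncX strunc_var /B /= ifN// expr0n.
  by rewrite gtn_eqF ?card_fibre_gt0 ?root_mapK.
transitivity (\sum_(f : {ffun 'I_n -> 'I_N.+1}) \sum_(g in compatible e (h f))
    \prod_(x | root_map (h f) g x == x) wt (f x) #|fibre (root_map (h f) g) x|); last first.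
  rewrite (exchange_big_dep xpredT)//= pair_big_dep; apply: eq_big => [[g f]|[g f]] /=.
    by apply/compatibleP/idP => [gf|/set_mem//]; exact/mem_set.
  move=> /compatibleP[_ _ gf]; rewrite root_terms// strunc_prod.
  by apply: eq_bigr => x _; rewrite ffunE.
(* For a fixed coloring the orientations are counted by their root map; exchanging the sums then
   lets the colors of each block be summed independently. *)
transitivity (\sum_(f : {ffun 'I_n -> 'I_N.+1}) \sum_(r : {ffun 'I_n -> 'I_n} |
    [forall v, f (r v) == f v]) (a r)%:R *
    \prod_(x | r x == x) wt (f x) #|fibre r x|); last first.
  apply: eq_bigr => f _; rewrite (sum_compatible (h f) e_sym
    (fun r => \prod_(x | r x == x) wt (f x) #|fibre r x|)).
  by apply: eq_bigl => r; apply: eq_forallb => v; rewrite !ffunE.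
rewrite (exchange_big_dep xpredT)//= strunc_sum; apply: eq_bigr => r _.
rewrite struncM [strunc _ _%:R]rmorph_nat strunc_prod -mulr_sumr.
have [a0|/rooted_idempotent rr] := eqVneq (a r) 0%N; first by rewrite a0 !mul0r.
congr (_ * _); rewrite -(prod_sum_idempotent ord0 (fun x c => wt c #|fibre r x|) rr).
by apply: eq_bigr => x /eqP rx; rewrite wtE// card_fibre_gt0.
Qed.
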